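(* Let $d\ge 3$ and let $E\subset\mathbb{R}^d$ be a bounded measurable set of positive Lebesgue measure. Then a translate of $E$ can be reconstructed using $d$ sets; that is, there are measurable sets $T_1,\dots,T_d\subset\mathbb{R}^d$ such that if $x,x'\in\mathbb{R}^d$ and $x\neq x'$ then $\lambda^d((E+x)\cap T_i)\neq\lambda^d((E+x')\cap T_i)$ for some $i\in\{1,\dots,d\}$.
   Context: $\lambda^d$ denotes Lebesgue measure on $\mathbb{R}^d$. *)

(* Defs.v *)
From HB Require Import structures.
From mathcomp Require Import all_boot all_order all_algebra.
From mathcomp Require Import all_classical all_reals all_analysis.

Set Implicit Arguments.
Unset Strict Implicit.
Unset Printing Implicit Defensive.

Import Order.TTheory GRing.Theory Num.Theory.
Import numFieldNormedType.Exports.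

Local Open Scope classical_set_scope.
Local Open Scope ring_scope.

Section lebesgue_rV.
Context {R : realType} {d : nat}.
Implicit Types (a b x : 'rV[R]_d) (A : set 'rV[R]_d).

Definition box a b : set 'rV[R]_d :=
  [set x | forall i, a 0 i < x 0 i <= b 0 i].

(* [box a b] is empty as soon as [b 0 i <= a 0 i] for some [i], hence the
   truncation at 0. *)
Definition box_volume a b : R := \prod_(i < d) Num.max 0 (b 0 i - a 0 i).

Definition box_cover A : set (('rV[R]_d * 'rV[R]_d)^nat) :=
  [set F | A `<=` \bigcup_k box (F k).1 (F k).2].

(* Lebesgue outer measure, defined on every subset of R^d; Lebesgue measure is
   its restriction to the Lebesgue-measurable sets below.  (For d = 0 every box
   is the whole one-point space, so the definition is meaningful for 0 < d
   only.) *)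
Definition lebesgue_rV A : \bar R :=
  ereal_inf [set (\sum_(k <oo) (box_volume (F k).1 (F k).2)%:E)%E
            | F in box_cover A].

(* Caratheodory's criterion: this is the full (complete) Lebesgue sigma-algebra,
   not only the Borel sets. *)
Definition lebesgue_measurable A : Prop := lebesgue_rV.-caratheodory A.

Definition translate A x : set 'rV[R]_d := [set y + x | y in A].

End lebesgue_rV.

Section lebesgue_rV_outer_measure.
Local Open Scope ereal_scope.
Context (R : realType) (d : nat).
Local Notation V := 'rV[R]_d.+1.
Local Notation mu := (@lebesgue_rV R d.+1).

Lemma box_volume_ge0 (p : V * V) : 0 <= (box_volume p.1 p.2)%:E.
Proof.
by rewrite lee_fin; apply: prodr_ge0 => i _; rewrite le_max lexx.
Qed.

Lemma lebesgue_rV_ge0 (A : set V) : 0 <= mu A.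
Proof.
apply: le_ereal_inf_tmp => x [F _ <-].
by apply: nneseries_ge0 => k _ _; exact: box_volume_ge0.
Qed.

Lemma lebesgue_rV0 : mu set0 = 0.
Proof.
apply/eqP; rewrite eq_le lebesgue_rV_ge0 andbT.
apply: ereal_inf_lbound; exists (fun=> (0%R, 0%R)) => //.
apply: eseries0 => k _ _ /=; rewrite /box_volume (bigD1 ord0)//=.
by rewrite !mxE subrr maxxx mul0r.
Qed.

Lemma le_lebesgue_rV : {homo mu : A B / A `<=` B >-> A <= B}.
Proof.
move=> A B AB; apply/ereal_inf_le_tmp => x [F BF <-].
by exists F => //; exact: subset_trans AB BF.
Qed.

Lemma lebesgue_rV_sigma_subadditive : sigma_subadditive mu.
Proof.
move=> A; have [[i ioo]|] := pselect (exists i, mu (A i) = +oo).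
  rewrite (eseries_pinfty _ _ ioo) ?leey// => n _.
  by rewrite -ltNye (lt_le_trans _ (lebesgue_rV_ge0 _)).
rewrite -forallNE => Aoo.
suff add2e (e : {posnum R}) :
    mu (\bigcup_n A n) <= \sum_(i <oo) mu (A i) + e%:num%:E.
  by apply/lee_addgt0Pr => _/posnumP[].
rewrite (le_trans _ (epsilon_trick _ _ _))//; last first.
  by move=> n; exact: lebesgue_rV_ge0.
pose vol (p : V * V) := (box_volume p.1 p.2)%:E.
pose P n (F : (V * V)^nat) := box_cover (A n) F /\
  \sum_(k <oo) vol (F k) <= mu (A n) + (e%:num / (2 ^ n.+1)%:R)%:E.
have [G PG] : {G : ((V * V)^nat)^nat & forall n, P n (G n)}.
  apply: (@choice _ _ P) => n; rewrite /P.
  have en1 : (0 < e%:num / (2 ^ n.+1)%:R)%R by [].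
  have fin : mu (A n) \is a fin_num.
    by rewrite ge0_fin_numE ?lebesgue_rV_ge0// ltey; apply/eqP/Aoo.
  have [x [F AF <-] xS] := lb_ereal_inf_adherent en1 fin.
  by exists F; split => //; exact/ltW.
have volG_ge0 x : 0 <= (vol \o uncurry G) x by exact: box_volume_ge0.
apply: (@le_trans _ _ (\esum_(i in setT) (vol \o uncurry G) i)).
  apply: ereal_inf_lbound => /=.
  have /card_esym/ppcard_eqP[f] := card_nat2.
  exists (uncurry G \o f).
    move=> t [i _ /(PG i).1[j _ ?]]; exists (f^-1%FUN (i, j)) => //=.
    by rewrite invK ?inE.
  rewrite -(esum_pred_image (vol \o uncurry G) _ xpredT) ?[fun=> _]set_true//.
  by rewrite image_eq.
rewrite (_ : esum _ _ = \sum_(i <oo) \sum_(j <oo ) vol (G i j)); last first.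
  pose J : nat -> set (nat * nat) := fun i => [set (i, j) | j in setT].
  rewrite (_ : setT = \bigcup_k J k); last first.
    by rewrite predeqE => -[a b]; split => // _; exists a => //; exists b.
  rewrite esum_bigcupT /=; last 2 first.
    - apply/trivIsetP => i j _ _ ij.
      rewrite predeqE => -[n m] /=; split => //= -[] [_] _ [<-{n} _].
      by move=> [m' _] [] /esym/eqP; rewrite (negbTE ij).
    - by move=> /= [n m]; exact: box_volume_ge0.
  rewrite -(image_id [set: nat]) -fun_true esum_pred_image//; last first.
    by move=> n _; apply: esum_ge0 => p _; exact: volG_ge0.
  apply: eq_eseriesr => /= j _.
  rewrite -(esum_pred_image (vol \o uncurry G) (pair j) predT)//=; last 2 first.
  - by move=> n _; exact: box_volume_ge0.
  - by move=> ? ? _ _; exact: (@can_inj _ _ _ snd).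
  by congr esum; rewrite predeqE => -[a b]; split; move=> [i _ <-]; exists i.
apply: lee_lim.
- apply: is_cvg_nneseries => n *.
  by apply: nneseries_ge0 => m *; exact: (volG_ge0 (n, m)).
- by apply: is_cvg_nneseries => n *; apply: adde_ge0 => //;
    exact: lebesgue_rV_ge0.
- by near=> n; apply: lee_sum => i _; exact: (PG i).2.
Unshelve. all: by end_near. Qed.

HB.instance Definition _ := isOuterMeasure.Build R V mu
  lebesgue_rV0 lebesgue_rV_ge0 le_lebesgue_rV lebesgue_rV_sigma_subadditive.

End lebesgue_rV_outer_measure.

(* Main.v *)
(* For a direction v the overlap of E + x with the ridge set {y | <y, v> in S}
   depends only on <x, v>; it is g(<x, v>) with g(u) = mu {y in E | <y, v> + u in S}.
   So it suffices to find d directions separating the points of R^d and, for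
   each of them, a set S for which g is strictly increasing.

   Let E lie in a cube Q of side P.  For v = 3 e_i + s e_j + t e_k the n-th
   Fourier coefficient c_n(s, t) of the distribution of <y, v> on E is the Fourier
   transform of E at the frequency (3n, ns, nt).  The squares [0, n]^2 are tiled
   by the unit squares (m, l) + [0, 1]^2, so Bessel's inequality in L^2(Q), applied
   for each offset, bounds the integral of sum_n n^2 |c_n(s, t)|^2 over [0, 1]^2.
   This is where three coordinates are needed: the Jacobian n^2 of
   (s, t) |-> (ns, nt) is exactly one derivative in L^2.  Hence for some (s, t)
   the distribution of <y, v> is of class H^1.

   The set S fills a fraction phi of each cell of a partition of the line into
   short intervals, phi being a smooth increasing function.  The error 1_S - phi
   has mean almost 0 on each cell, so its low frequencies are small, while those
   of high frequency are damped by the H^1 bound; thus replacing 1_S by phi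
   changes g(u + tau) - g(u) by at most eps tau, less than the increase due to
   phi. *)

Require Import Defs.
From mathcomp Require Import all_boot all_order all_algebra.
From mathcomp Require Import all_classical all_reals all_analysis.
From mathcomp Require Import measurable_realfun ring lra.

Set Implicit Arguments.
Unset Strict Implicit.
Unset Printing Implicit Defensive.

Import Order.TTheory GRing.Theory Num.Theory.
Import numFieldNormedType.Exports.

Local Open Scope classical_set_scope.
Local Open Scope ring_scope.

(** * Lebesgue measure on R^d *)

(** The overlap must increase along the whole line while [phi] is bounded, so the increments of
    [phi] over a fixed step tend to 0 far away. The admissible error therefore depends on the
    position, and no single cell length will do. The line is covered by windows of length [P]
    starting at the integers; each window prescribes how fine the cells must be, and each unit
    interval obeys all the windows that contain it. This is not circular, because the bound on the
    error names its threshold frequency and its tolerance before the set is chosen.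

    [P] has two roles: it is the side of the cube, hence the period in Bessel's inequality, and it
    is so long that [X + t] and [X + t + tau] stay inside one window, where only one period of the
    error is seen.

    The harmonic analysis is kept finite. The mean over the directions is a sum over a grid,
    followed by a compactness argument. The Fourier series of the error is a discrete transform at
    dyadic points, and Fejer means recover the error away from its jumps, which are met on a null
    set only. *)

Section lebesgue_rV_basics.
Context {R : realType} {d : nat}.
Local Notation V := 'rV[R]_d.+1.
Local Notation mu := (@lebesgue_rV R d.+1).
Implicit Types (a b v : V) (A B : set V).

Lemma translateE A v : translate A v = [set y | A (y - v)].
Proof.
apply/seteqP; split => [y [z Az <-]|y Ay]; first by rewrite /= addrK.
by exists (y - v) => //; rewrite subrK.
Qed.

Lemma lebesgue_rV_translate_le A v : (mu (translate A v) <= mu A)%E.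
Proof.
apply: le_ereal_inf_tmp => _ [F AF <-]; apply: ereal_inf_lbound.
exists (fun k => ((F k).1 + v, (F k).2 + v)).
- move=> y; rewrite translateE => /AF[k _ Fk]; exists k => // i /=.
  by have := Fk i; rewrite !mxE lerBlDr ltrBrDr.
- apply: eq_eseriesr => k _ /=; congr (_%:E).
  by apply: eq_bigr => i _; congr Num.max; rewrite !mxE; ring.
Qed.

Lemma lebesgue_rV_translate A v : mu (translate A v) = mu A.
Proof.
apply/eqP; rewrite eq_le lebesgue_rV_translate_le /=.
rewrite -[X in (mu X <= _)%E](_ : translate (translate A v) (- v) = A).
  exact: lebesgue_rV_translate_le.
by rewrite !translateE; apply/seteqP; split => y /=; rewrite opprK addrK.
Qed.

Lemma lebesgue_rV_box_le a b : (mu (box a b) <= (box_volume a b)%:E)%E.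
Proof.
apply: ereal_inf_lbound.
exists (fun k : nat => if k is 0%N then (a, b) else (0 : V, 0 : V)); first by move=> x; exists 0%N.
rewrite (@nneseries_split _ _ 0 1)//; last first.
  by move=> k _; exact: (@box_volume_ge0 _ _ (if k is 0%N then (a, b) else (0, 0))).
rewrite big_mkord big_ord1 /= eseries0 ?adde0// => -[//|k] _ _ /=.
by rewrite /box_volume (bigD1 ord0)//= !mxE subrr maxxx mul0r.
Qed.

Definition set_coord (i : 'I_d.+1) (c : R) a : V :=
  \row_j (if j == i then c else a 0 j).

(** The cut is clamped by [min] and [max]: for a box on one side of the hyperplane, one of the
    pieces is empty and the truncation at 0 gives it volume 0. *)
Lemma box_volume_split (i : 'I_d.+1) (c : R) a b :
  box_volume a b = box_volume a (set_coord i (Num.min (b 0 i) c) b) +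
                   box_volume (set_coord i (Num.max (a 0 i) c) a) b.
Proof.
rewrite /box_volume (bigD1 i)//= [X in _ = X + _](bigD1 i)//= [X in _ = _ + X](bigD1 i)//=.
rewrite !mxE eqxx.
rewrite [in X in _ = X + _](eq_bigr (fun j => Num.max 0 (b 0 j - a 0 j))); last first.
  by move=> j ji; rewrite mxE (negbTE ji).
rewrite [in X in _ = _ + X](eq_bigr (fun j => Num.max 0 (b 0 j - a 0 j))); last first.
  by move=> j ji; rewrite mxE (negbTE ji).
rewrite -mulrDl; congr (_ * _).
by rewrite /Num.max /Num.min; repeat case: ifPn; rewrite -?leNgt; lra.
Qed.

(** The hyperplane cuts every box of a cover into two boxes whose volumes add up; the two families
    cover the two parts of the test set. *)
Lemma halfspace_measurable (i : 'I_d.+1) (c : R) :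
  lebesgue_measurable [set x : V | x 0 i <= c].
Proof.
apply: le_caratheodory_measurable => A.
apply: le_ereal_inf_tmp => _ [F AF <-].
pose F1 k := ((F k).1, set_coord i (Num.min ((F k).2 0 i) c) (F k).2).
pose F2 k := (set_coord i (Num.max ((F k).1 0 i) c) (F k).1, (F k).2).
have -> : (\sum_(k <oo) (box_volume (F k).1 (F k).2)%:E =
  \sum_(k <oo) (box_volume (F1 k).1 (F1 k).2)%:E +
  \sum_(k <oo) (box_volume (F2 k).1 (F2 k).2)%:E)%E.
  rewrite -nneseriesD; last 2 first.
  - by move=> k _ _; exact: box_volume_ge0.
  - by move=> k _ _; exact: box_volume_ge0.
  by apply: eq_eseriesr => k _; rewrite -EFinD; congr (_%:E); exact: box_volume_split.
apply: leeD; apply: ereal_inf_lbound.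
- exists F1 => // x [/AF[k _ Fk]] /= xc; exists k => // j /=.
  have := Fk j; rewrite mxE; case: eqP => [->|//] /andP[-> /=].
  by rewrite le_min xc andbT.
- exists F2 => // x [/AF[k _ Fk]] /= /negP; rewrite -ltNge => xc; exists k => // j /=.
  have := Fk j; rewrite mxE; case: eqP => [->|//] /andP[/= ax ->].
  by rewrite gt_max xc ax.
Qed.

End lebesgue_rV_basics.

(** * Bessel's inequality *)

(* Covers both the integral over a set of finite measure and the mean over a
   finite grid. *)
Record positive_functional {R : realType} {T : Type} (adm : set (T -> R))
    (J : (T -> R) -> R) : Prop := PositiveFunctional {
  pf_cst : forall c, adm (fun=> c);
  pf_add : forall f g, adm f -> adm g -> adm (fun x => f x + g x);
  pf_mul : forall f g, adm f -> adm g -> adm (fun x => f x * g x);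
  pfD : forall f g, adm f -> adm g -> J (fun x => f x + g x) = J f + J g;
  pfZ : forall c f, adm f -> J (fun x => c * f x) = c * J f;
  pf_ge0 : forall f, adm f -> (forall x, 0 <= f x) -> 0 <= J f }.

Section positive_functional_theory.
Context {R : realType} {T : Type} {adm : set (T -> R)} {J : (T -> R) -> R}.
Hypothesis pJ : positive_functional adm J.

Lemma pf_scale c f : adm f -> adm (fun x => c * f x).
Proof. by move=> ?; apply: (pf_mul pJ) => //; exact: (pf_cst pJ). Qed.

Lemma pf_opp f : adm f -> adm (fun x => - f x).
Proof.
by move=> /(@pf_scale (-1)); congr adm; apply/funext => x; rewrite mulN1r.
Qed.

Lemma pf_sub f g : adm f -> adm g -> adm (fun x => f x - g x).
Proof. by move=> af /pf_opp ag; exact: (pf_add pJ). Qed.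

Lemma pfN f : adm f -> J (fun x => - f x) = - J f.
Proof.
move=> af; rewrite -mulN1r -(pfZ pJ)//; congr J.
by apply/funext => x; rewrite mulN1r.
Qed.

Lemma pfB f g : adm f -> adm g -> J (fun x => f x - g x) = J f - J g.
Proof. by move=> af ag; rewrite (pfD pJ)// ?pfN//; exact: pf_opp. Qed.

Lemma pf_sum (I : Type) (r : seq I) (F : I -> T -> R) :
  (forall i, adm (F i)) -> adm (fun x => \sum_(i <- r) F i x).
Proof.
move=> aF; elim: r => [|i r IH].
  by under [X in adm X]eq_fun do rewrite big_nil; exact: (pf_cst pJ).
by under [X in adm X]eq_fun do rewrite big_cons; exact: (pf_add pJ).
Qed.

Lemma pfsum (I : Type) (r : seq I) (F : I -> T -> R) :
  (forall i, adm (F i)) ->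
  J (fun x => \sum_(i <- r) F i x) = \sum_(i <- r) J (F i).
Proof.
move=> aF; elim: r => [|i r IH].
  under [X in J X]eq_fun do rewrite big_nil.
  rewrite big_nil -[RHS](mul0r (J (fun=> 0))) -(pfZ pJ); last exact: (pf_cst pJ).
  by congr J; apply/funext => x; rewrite mul0r.
under [X in J X]eq_fun do rewrite big_cons.
by rewrite big_cons -IH -(pfD pJ)//; exact: pf_sum.
Qed.

(* The phases [u i] stand for the characters [exp (i u)]: orthogonality of the
   characters is the vanishing of the means of [cos] and [sin] of the phase
   differences, and the squared modulus of a Fourier coefficient is split into
   its real and imaginary parts. *)
Lemma bessel (I : finType) (u : I -> T -> R) (V : R) (f : T -> R) :
  0 < V -> adm f ->
  (forall i, adm (fun x => cos (u i x))) ->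
  (forall i, adm (fun x => sin (u i x))) ->
  (forall i j, J (fun x => cos (u i x - u j x)) = if i == j then V else 0) ->
  (forall i j, J (fun x => sin (u i x - u j x)) = 0) ->
  \sum_i (J (fun x => f x * cos (u i x)) ^+ 2 +
          J (fun x => f x * sin (u i x)) ^+ 2) <= V * J (fun x => f x * f x).
Proof.
move=> V0 af ac asn Jc Js.
pose A i := J (fun x => f x * cos (u i x)).
pose B i := J (fun x => f x * sin (u i x)).
pose S := \sum_i (A i ^+ 2 + B i ^+ 2).
pose G x := \sum_i (A i * cos (u i x) + B i * sin (u i x)).
(* [G + i H] is the sum of [(A i - i B i) exp(i u i)], the projection of [f] times [V]. Adding
   [H ^ 2] below completes a squared modulus, in which only phase differences occur. *)
pose H x := \sum_i (A i * sin (u i x) - B i * cos (u i x)).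
have aG : adm G.
  by apply: pf_sum => i; apply: (pf_add pJ); exact: pf_scale.
have aH : adm H.
  by apply: pf_sum => i; apply: pf_sub; exact: pf_scale.
have JfG : J (fun x => f x * G x) = S.
  rewrite [X in J X](_ : _ = fun x => \sum_i
      (A i * (f x * cos (u i x)) + B i * (f x * sin (u i x)))); last first.
    by apply/funext => x; rewrite mulr_sumr; apply: eq_bigr => i _; ring.
  have a1 i : adm (fun x => f x * cos (u i x)) by exact: (pf_mul pJ).
  have a2 i : adm (fun x => f x * sin (u i x)) by exact: (pf_mul pJ).
  rewrite pfsum; last by move=> i; apply: (pf_add pJ); exact: pf_scale.
  apply: eq_bigr => i _; rewrite (pfD pJ); [|exact: pf_scale|exact: pf_scale].
  by rewrite !(pfZ pJ)// -!expr2.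
have acd i j : adm (fun x => cos (u i x - u j x)).
  under [X in adm X]eq_fun do rewrite cosB.
  by apply: (pf_add pJ); exact: (pf_mul pJ).
have asd i j : adm (fun x => sin (u i x - u j x)).
  under [X in adm X]eq_fun do rewrite sinB.
  by apply: pf_sub; exact: (pf_mul pJ).
have JGH : J (fun x => G x * G x + H x * H x) = V * S.
  rewrite [X in J X](_ : _ = fun x => \sum_i \sum_j
      ((A i * A j + B i * B j) * cos (u i x - u j x) +
       (B i * A j - A i * B j) * sin (u i x - u j x))); last first.
    apply/funext => x; rewrite /G /H !mulr_suml -big_split/=; apply: eq_bigr => i _.
    by rewrite !mulr_sumr -big_split/=; apply: eq_bigr => j _; rewrite cosB sinB; ring.
  have a1 i j : adm (fun x => (A i * A j + B i * B j) * cos (u i x - u j x)).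
    exact: pf_scale.
  have a2 i j : adm (fun x => (B i * A j - A i * B j) * sin (u i x - u j x)).
    exact: pf_scale.
  have a3 i j : adm (fun x => (A i * A j + B i * B j) * cos (u i x - u j x) +
     (B i * A j - A i * B j) * sin (u i x - u j x)) by exact: (pf_add pJ).
  rewrite pfsum; last by move=> i; exact: pf_sum.
  rewrite mulr_sumr; apply: eq_bigr => i _.
  rewrite pfsum//.
  rewrite (bigD1 i)//= big1 ?addr0; last first.
    move=> j ji; rewrite (pfD pJ)// !(pfZ pJ)// Jc Js eq_sym (negbTE ji).
    by rewrite !mulr0 addr0.
  by rewrite (pfD pJ)// !(pfZ pJ)// Jc Js eqxx; ring.
have aVG : adm (fun x => V * f x - G x) by apply: pf_sub => //; exact: pf_scale.
have : 0 <= J (fun x => (V * f x - G x) * (V * f x - G x) + H x * H x).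
  apply: (pf_ge0 pJ) => [|x]; last by rewrite addr_ge0// -expr2 sqr_ge0.
  by apply: (pf_add pJ); exact: (pf_mul pJ).
rewrite [X in J X](_ : _ = fun x => V ^+ 2 * (f x * f x) +
   (- (2 * V) * (f x * G x) + (G x * G x + H x * H x))); last first.
  by apply/funext => x; ring.
have b1 : adm (fun x => f x * f x) by exact: (pf_mul pJ).
have b2 : adm (fun x => f x * G x) by exact: (pf_mul pJ).
have b3 : adm (fun x => G x * G x + H x * H x).
  by apply: (pf_add pJ); exact: (pf_mul pJ).
rewrite (pfD pJ); [|exact: pf_scale|apply: (pf_add pJ) => //; exact: pf_scale].
rewrite (pfD pJ)//; last exact: pf_scale.
rewrite !(pfZ pJ)// JfG JGH => h.
rewrite -/S -(ler_pM2l V0); rewrite -subr_ge0.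
by apply: le_trans h _; rewrite le_eqVlt; apply/orP; left; apply/eqP; ring.
Qed.

End positive_functional_theory.

(** * Integration over bounded sets *)

Section bounded_measurable.
Context {dT} {T : measurableType dT} {R : realType}.
Variables (mu : {measure set T -> \bar R}) (D : set T).
Hypotheses (mD : measurable D) (muD : (mu D < +oo)%E).

Definition bounded_measurable (f : T -> R) : Prop :=
  measurable_fun D f /\ exists M, forall x, D x -> `|f x| <= M.

Lemma bounded_measurable_integrable f :
  bounded_measurable f -> mu.-integrable D (EFin \o f).
Proof.
move=> [mf [M fM]]; apply: measurable_bounded_integrable => //.
by exists M; split; [exact: num_real|move=> N MN x Dx; apply: le_trans (ltW MN); exact: fM].
Qed.

Lemma Rintegral_positive_functional :
  positive_functional bounded_measurable (fun f => \int[mu]_(x in D) f x).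
Proof.
split.
- by move=> c; split; [exact: measurable_cst|exists `|c|].
- move=> f g [mf [M fM]] [mg [N gN]]; split; first exact: measurable_funD.
  exists (M + N) => x Dx; rewrite (le_trans (ler_normD _ _))// lerD//.
    exact: fM.
  exact: gN.
- move=> f g [mf [M fM]] [mg [N gN]]; split; first exact: measurable_funM.
  exists (M * N) => x Dx; rewrite normrM ler_pM//; [exact: fM|exact: gN].
- by move=> f g bf bg; rewrite RintegralD//; exact: bounded_measurable_integrable.
- by move=> c f bf; rewrite RintegralZl//; exact: bounded_measurable_integrable.
- by move=> f _ f0; apply: Rintegral_ge0 => x _; exact: f0.
Qed.

Lemma bounded_convergence (F : nat -> T -> R) (f : T -> R) (M : R) (N : set T) :
  (forall n, measurable_fun D (F n)) -> measurable_fun D f ->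
  (forall n x, D x -> `|F n x| <= M) ->
  mu.-negligible N -> (forall x, D x -> ~ N x -> F n x @[n --> \oo] --> f x) ->
  \int[mu]_(x in D) F n x @[n --> \oo] --> \int[mu]_(x in D) f x.
Proof.
move=> mF mf FM negN Ff.
have [] := @dominated_convergence _ _ _ mu D mD (fun n => EFin \o F n) (EFin \o f)
  (EFin \o cst M).
- by move=> n; exact/measurable_EFinP.
- exact/measurable_EFinP.
- case: negN => A [mA A0 NA]; exists A; split => // x /= /not_implyP[Dx Fx].
  apply: NA; apply: contrapT => Nx; apply: Fx; apply/cvg_EFin; first exact: nearW.
  exact: Ff.
- apply: bounded_measurable_integrable; split; first exact: measurable_cst.
  by exists `|M|.
- by apply: aeW => x n Dx; rewrite lee_fin; exact: FM.
move=> intf _ h; apply: fine_cvg; rewrite fineK//.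
exact: integrable_fin_num.
Qed.

End bounded_measurable.

(** * Lebesgue measure on its sigma-algebra, and translations *)

Section rV_measure.
Context {R : realType} {d : nat}.
Local Notation V := 'rV[R]_d.+1.

Definition rV_outer : {outer_measure set V -> \bar R} := @lebesgue_rV R d.+1.
(** An alias of ['rV[R]_d.+1] whose measurable sets are those of Caratheodory's criterion; the casts
    to [set T] below select this structure. *)
Definition rV_type := caratheodory_type rV_outer.
Definition rV_measure : {measure set rV_type -> \bar R} := rV_outer.
Local Notation mu := rV_measure.
Implicit Types (a b v : V) (A B D : set V) (i p : 'I_d.+1) (k : 'I_d.+1 -> R).

Lemma measurable_rVE (A : set rV_type) : measurable A = @lebesgue_measurable R d.+1 A.
Proof. by []. Qed.

Lemma measurable_coord i : measurable_fun [set: rV_type] (fun x : rV_type => (x : V) 0 i).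
Proof.
apply: (measurability _ (RGenOInfty.measurableE R)) => _ [_ [c ->] <-].
rewrite setTI.
rewrite [X in measurable X](_ : _ = ~` [set x : V | x 0 i <= c]).
  by apply: measurableC; exact: halfspace_measurable.
by apply/seteqP; split => x /=; rewrite in_itv/= andbT ltNge => /negP.
Qed.

Definition linear_form k (x : V) : R := \sum_q k q * x 0 q.

Lemma linear_formD k x y : linear_form k (x + y) = linear_form k x + linear_form k y.
Proof.
by rewrite /linear_form -big_split; apply: eq_bigr => q _; rewrite mxE mulrDr.
Qed.

Lemma linear_form_delta k p c : linear_form k (c *: delta_mx 0 p) = k p * c.
Proof.
rewrite /linear_form (bigD1 p)//= big1 ?addr0 ?mxE ?eqxx/= ?mulr1// => q qp.
by rewrite !mxE (negbTE qp) andbF !mulr0.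
Qed.

Lemma measurable_linear_form k :
  measurable_fun [set: rV_type] (linear_form k : rV_type -> R).
Proof.
apply: (@measurable_sum _ rV_type) => q.
by apply: measurable_funM; [exact: measurable_cst|exact: measurable_coord].
Qed.

Lemma translate_measurable A v :
  lebesgue_measurable A -> lebesgue_measurable (translate A v).
Proof.
move=> mA X; rewrite -(lebesgue_rV_translate X (- v)) (mA (translate X (- v))).
rewrite -(lebesgue_rV_translate (translate X (- v) `&` A) v).
rewrite -(lebesgue_rV_translate (translate X (- v) `&` ~` A) v).
by congr (_ + _)%E; congr lebesgue_rV; rewrite !translateE;
  apply/seteqP; split => y /=; rewrite opprK subrK.
Qed.

Definition shift v (x : rV_type) : rV_type := (x : V) + v.

Lemma measurable_shift v : measurable_fun [set: rV_type] (shift v).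
Proof.
move=> _ A mA; rewrite setTI.
rewrite (_ : _ @^-1` _ = translate (A : set V) (- v)); first exact: translate_measurable.
by rewrite translateE; apply/seteqP; split => x /=; rewrite opprK.
Qed.

Lemma pushforward_shift v A : pushforward mu (shift v) A = mu A.
Proof.
rewrite /pushforward -[RHS](lebesgue_rV_translate A (- v)) translateE.
by congr lebesgue_rV; apply/seteqP; split => x /=; rewrite opprK.
Qed.

Lemma Rintegral_shift v (D : set rV_type) (f : rV_type -> R) : measurable D ->
  (mu D < +oo)%E -> measurable_fun setT f -> (exists M, forall x, `|f x| <= M) ->
  \int[mu]_(x in shift v @^-1` D) f (shift v x) = \int[mu]_(x in D) f x.
Proof.
move=> mD muD mf [M fM]; rewrite /Rintegral; congr fine.
have msD : measurable (shift v @^-1` D).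
  by rewrite -[X in measurable X]setTI; exact: measurable_shift.
have muDs : (mu (shift v @^-1` D) < +oo)%E.
  by rewrite -[X in (X < _)%E]/(pushforward mu (shift v) D) pushforward_shift.
have intf : mu.-integrable (shift v @^-1` D) ((EFin \o f) \o shift v).
  apply: (bounded_measurable_integrable msD muDs (f := f \o shift v)).
  split; last by exists M => x _; exact: fM.
  exact: measurable_funTS (measurableT_comp mf (measurable_shift v)).
have mEf : measurable_fun setT (EFin \o f) by exact/measurable_EFinP.
rewrite -(integral_pushforward (measurable_shift v) mEf intf mD).
apply: eq_measure_integral; first exact: measurable_shift.
by move=> mshift A mA _; exact: pushforward_shift.
Qed.

End rV_measure.

(** * Trigonometric integrals over boxes; hyperplanes are null sets *)

Section boxes.
Context {R : realType} {d : nat}.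
Local Notation V := 'rV[R]_d.+1.
Local Notation T := (@rV_type R d).
Local Notation mu := (@rV_measure R d).
Implicit Types (a b v : V) (A B D : set V) (i p : 'I_d.+1) (k : 'I_d.+1 -> R).

Lemma measurable_coord_le i c : measurable ([set x : V | x 0 i <= c] : set T).
Proof. exact: halfspace_measurable. Qed.

Lemma measurable_coord_gt i c : measurable ([set x : V | c < x 0 i] : set T).
Proof.
rewrite (_ : [set _ | _] = ~` ([set x : V | x 0 i <= c] : set T)).
  by apply: measurableC; exact: measurable_coord_le.
by apply/seteqP; split => x /=; rewrite ltNge => /negP.
Qed.

Lemma measurable_box a b : measurable (box a b : set T).
Proof.
rewrite (_ : box a b = \bigcap_(i in [set: 'I_d.+1])
   (([set x : V | a 0 i < x 0 i] `&` [set x : V | x 0 i <= b 0 i]) : set T)).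
  apply: fin_bigcap_measurable => // i _.
  by apply: measurableI; [exact: measurable_coord_gt|exact: measurable_coord_le].
apply/seteqP; split => x /= h i; first by move=> _; exact/andP/h.
by apply/andP; exact: h.
Qed.

Lemma measure_box_lty a b : (mu (box a b) < +oo)%E.
Proof. by apply: le_lt_trans (lebesgue_rV_box_le a b) _; rewrite ltry. Qed.

(** The shift by [v] carries the slab [Q1] onto [R1]. The remaining slab [Q2] leaves the box, but by
    periodicity it may be shifted by [v - P] instead, which carries it onto [R2]. *)
Lemma Rintegral_box_periodic a b p (P v : R) (f : T -> R) :
  b 0 p - a 0 p = P -> 0 <= v <= P ->
  measurable_fun setT f -> (exists M, forall x, `|f x| <= M) ->
  (forall x : V, f (x + P *: delta_mx 0 p) = f x) ->
  \int[mu]_(x in box a b) f (shift (v *: delta_mx 0 p) x) =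
  \int[mu]_(x in box a b) f x.
Proof.
move=> bP /andP[v0 vP] mf bf fP.
pose e : V := delta_mx 0 p.
have eE y q : (y *: e) 0 q = if q == p then y else 0.
  by rewrite !mxE eqxx/=; case: (q == p); rewrite ?mulr1 ?mulr0.
pose Q1 : set T := box a b `&` [set x : V | x 0 p <= b 0 p - v].
pose Q2 : set T := box a b `&` [set x : V | b 0 p - v < x 0 p].
pose R1 : set T := box a b `&` [set x : V | a 0 p + v < x 0 p].
pose R2 : set T := box a b `&` [set x : V | x 0 p <= a 0 p + v].
have mQ1 : measurable Q1.
  by apply: measurableI; [exact: measurable_box|exact: measurable_coord_le].
have mQ2 : measurable Q2.
  by apply: measurableI; [exact: measurable_box|exact: measurable_coord_gt].
have mR1 : measurable R1.
  by apply: measurableI; [exact: measurable_box|exact: measurable_coord_gt].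
have mR2 : measurable R2.
  by apply: measurableI; [exact: measurable_box|exact: measurable_coord_le].
have QU : (box a b : set T) = Q1 `|` Q2.
  rewrite -setIUr (_ : _ `|` _ = setT) ?setIT//.
  by apply/seteqP; split => // x _ /=; case: (leP (x 0 p) (b 0 p - v)) => ?; [left|right].
have RU : (box a b : set T) = R1 `|` R2.
  rewrite -setIUr (_ : _ `|` _ = setT) ?setIT//.
  by apply/seteqP; split => // x _ /=; case: (leP (x 0 p) (a 0 p + v)) => ?; [right|left].
have Q12 : [disjoint Q1 & Q2].
  by apply/disj_setPS => x [] [_ /= h1] [_ /=]; rewrite ltNge h1.
have R12 : [disjoint R1 & R2].
  by apply/disj_setPS => x [] [_ /= h1] [_ /=]; rewrite leNgt h1.
have fin (A : set T) : measurable A -> A `<=` box a b -> (mu A < +oo)%E.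
  move=> mA Ab; apply: le_lt_trans (measure_box_lty a b).
  by apply: le_measure => //; rewrite inE//; exact: measurable_box.
have mfs w : measurable_fun setT (f \o shift w).
  exact: measurableT_comp mf (measurable_shift w).
have intb (g : T -> R) (A : set T) : measurable A -> A `<=` box a b ->
    measurable_fun setT g -> (exists M, forall x, `|g x| <= M) ->
    mu.-integrable A (EFin \o g).
  move=> mA Ab mg [M gM]; apply: bounded_measurable_integrable => //.
    exact: fin.
  split; first exact: measurable_funTS.
  by exists M => x _.
have bfs w : exists M, forall x, `|(f \o shift w) x| <= M.
  by case: bf => M fM; exists M => x; exact: fM.
have sE w (x : V) q : shift (w *: e) x 0 q = x 0 q + if q == p then w else 0.
  by rewrite mxE eE.
have sp w (x : V) : shift (w *: e) x 0 p = x 0 p + w by rewrite sE eqxx.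
have S1 : shift (v *: e) @^-1` R1 = Q1.
  apply/seteqP; split => x [h h2]; rewrite /R1 /Q1 /= in h2 *; split => [q|].
  - have := h q; have := h2; rewrite sp sE.
    by case: eqP => [->|_]; rewrite ?addr0// => ? /andP[? ?]; apply/andP; split; lra.
  - by have := h p; rewrite sp => /andP[? ?]; lra.
  - have := h q; have := h2; rewrite sE.
    by case: eqP => [->|_]; rewrite ?addr0// => ? /andP[? ?]; apply/andP; split; lra.
  - by have := h p; rewrite sp => /andP[? ?]; lra.
have S2 : shift ((v - P) *: e) @^-1` R2 = Q2.
  apply/seteqP; split => x [h h2]; rewrite /R2 /Q2 /= in h2 *; split => [q|].
  - have := h q; have := h2; rewrite sp sE.
    by case: eqP => [->|_]; rewrite ?addr0// => ? /andP[? ?]; apply/andP; split; lra.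
  - by have := h p; rewrite sp => /andP[? ?]; lra.
  - have := h q; have := h2; rewrite sE.
    by case: eqP => [->|_]; rewrite ?addr0// => ? /andP[? ?]; apply/andP; split; lra.
  - by have := h p; rewrite sp => /andP[? ?]; lra.
have subQ1 : Q1 `<=` box a b by exact: subIsetl.
have subQ2 : Q2 `<=` box a b by exact: subIsetl.
have subR1 : R1 `<=` box a b by exact: subIsetl.
have subR2 : R2 `<=` box a b by exact: subIsetl.
have mb := measurable_box a b.
rewrite QU Rintegral_setU//; last first.
  by rewrite -QU; exact: (intb (f \o shift (v *: e)) _ mb (@subset_refl _ _) (mfs _) (bfs _)).
rewrite -QU RU Rintegral_setU//; last first.
  by rewrite -RU; exact: (intb f _ mb (@subset_refl _ _) mf bf).
rewrite -S1 -S2 Rintegral_shift//; last exact: fin.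
congr (_ + _).
rewrite -(@Rintegral_shift _ _ ((v - P) *: e) R2)//; last exact: fin.
apply: eq_Rintegral => x _; rewrite -(fP (shift ((v - P) *: e) x)).
by congr f; rewrite /shift -addrA -scalerDl subrK.
Qed.

(** The side is a multiple of the period [2 v] of [f], so the shift by [v] preserves the integral;
    it also changes its sign. *)
Lemma Rintegral_box_antiperiodic a b p (m : nat) (v : R) (f : T -> R) : (0 < m)%N ->
  b 0 p - a 0 p = v *+ (m.*2) -> 0 <= v ->
  measurable_fun setT f -> (exists M, forall x, `|f x| <= M) ->
  (forall x : V, f (x + v *: delta_mx 0 p) = - f x) ->
  \int[mu]_(x in box a b) f x = 0.
Proof.
move=> m0 bv v0 mf bf fv.
have fvn n x : f (x + (v *+ n) *: delta_mx 0 p : V) = (-1) ^+ n * f x.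
  elim: n => [|n IH]; first by rewrite mulr0n scale0r addr0 expr0 mul1r.
  by rewrite mulrS scalerDl addrCA addrC fv IH exprS mulN1r mulNr.
have := @Rintegral_box_periodic a b p _ v f bv.
have -> : (0 <= v <= v *+ m.*2).
  rewrite v0/= -[X in X <= _]mulr1 -mulr_natr ler_wpM2l// ler1n.
  by rewrite -addnn addn_gt0 m0.
move=> /(_ isT mf bf); rewrite (@eq_Rintegral _ T R mu _ (fun x => - f x)); last first.
  by move=> x _; rewrite -fv.
move=> h; have {h} : \int[mu]_(x in box a b) (- f x) = \int[mu]_(x in box a b) f x.
  by apply: h => x; rewrite fvn -mul2n exprM sqrrN expr1n expr1n mul1r.
have pf := @Rintegral_positive_functional _ T R mu _ (measurable_box a b) (measure_box_lty a b).
rewrite (pfN pf); last first.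
  by split; [exact: measurable_funTS|case: bf => M fM; exists M => x _].
by move=> h; lra.
Qed.

Lemma continuous_comp_measurable (g : R -> R) (f : T -> R) :
  continuous g -> measurable_fun setT f -> measurable_fun setT (g \o f).
Proof.
by move=> cg mf; apply: measurableT_comp => //; exact: continuous_measurable_fun.
Qed.

(** A shift along coordinate [p] by the side divided by [2 m] changes the phase by [pi] or [- pi],
    so [cos] and [sin] are antiperiodic. *)
Lemma Rintegral_box_trig a b p k (m : nat) : (0 < m)%N -> a 0 p < b 0 p ->
  `|k p| * (b 0 p - a 0 p) = pi *+ m.*2 ->
  \int[mu]_(x in box a b) cos (linear_form k x) = 0 /\
  \int[mu]_(x in box a b) sin (linear_form k x) = 0.
Proof.
move=> m0 ab kP.
pose v := (b 0 p - a 0 p) / m.*2%:R.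
have m20 : m.*2%:R != 0 :> R by rewrite pnatr_eq0 double_eq0 -lt0n.
have vE : b 0 p - a 0 p = v *+ m.*2 by rewrite -mulr_natr divfK.
have v0 : 0 <= v by rewrite divr_ge0// subr_ge0 ltW.
have kv : `|k p| * v = pi.
  by apply: (mulIf m20); rewrite -mulrA divfK// kP mulr_natr.
have [kpv|kpv] : k p * v = pi \/ k p * v = - pi.
- have [|] := leP 0 (k p) => hk; [left|right].
    by rewrite -kv ger0_norm.
  by rewrite -kv ltr0_norm// mulNr opprK.
- split; apply: (Rintegral_box_antiperiodic m0 vE v0).
  + exact: (continuous_comp_measurable (@continuous_cos R) (measurable_linear_form k)).
  + by exists 1 => x; exact: cos_max.
  + by move=> x; rewrite linear_formD linear_form_delta kpv cosDpi.
  + exact: (continuous_comp_measurable (@continuous_sin R) (measurable_linear_form k)).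
  + by exists 1 => x; exact: sin_max.
  + by move=> x; rewrite linear_formD linear_form_delta kpv sinDpi.
- split; apply: (Rintegral_box_antiperiodic m0 vE v0).
  + exact: (continuous_comp_measurable (@continuous_cos R) (measurable_linear_form k)).
  + by exists 1 => x; exact: cos_max.
  + move=> x; rewrite linear_formD linear_form_delta kpv.
    by rewrite -[in RHS](subrK pi (linear_form k x)) cosDpi opprK.
  + exact: (continuous_comp_measurable (@continuous_sin R) (measurable_linear_form k)).
  + by exists 1 => x; exact: sin_max.
  + move=> x; rewrite linear_formD linear_form_delta kpv.
    by rewrite -[in RHS](subrK pi (linear_form k x)) sinDpi opprK.
Qed.

(** The translates of the section by [1 / n.+1] along coordinate [p] are pairwise disjoint, of equal
    measure, and all lie in one larger box, so this measure is 0. *)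
Lemma measure_hyperplane0 a b p k c : k p != 0 ->
  mu (box a b `&` [set x : V | linear_form k x = c]) = 0%E.
Proof.
move=> kp0; set H : set T := _ `&` _.
have mH0 c' : measurable ([set x : V | linear_form k x = c'] : set T).
  rewrite -[X in measurable X]setTI.
  exact: (@measurable_linear_form R d k measurableT [set c'] (measurable_set1 _)).
have mH : measurable H by apply: measurableI; [exact: measurable_box|exact: mH0].
pose w n : R := n.+1%:R^-1.
pose B n : set T := translate H (w n *: delta_mx 0 p).
have mB n : measurable (B n) by exact: translate_measurable.
pose one : V := \row__ 1.
have subB n : B n `<=` box a (b + one).
  rewrite /B translateE => x [h _] q; have := h q; rewrite !mxE.
  have w0 : 0 <= w n by rewrite invr_ge0.
  have w1 : w n <= 1 by rewrite invf_le1// ler1n.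
  rewrite eqxx/=; case: (q == p) / eqP => [->|_]; rewrite ?mulr1 ?mulr0 ?subr0;
    by move=> /andP[? ?]; apply/andP; split; lra.
have tB : trivIset setT B.
  apply/trivIsetP => m n _ _ mn; apply/seteqP; split => // x.
  rewrite /B !translateE => -[[_ /= h1] [_ /= h2]].
  move: h1; rewrite -h2 !linear_formD -!scaleNr !linear_form_delta => /addrI.
  move=> /(mulfI kp0)/oppr_inj/invr_inj/eqP; rewrite eqr_nat eqSS.
  by rewrite (negbTE mn).
have muB n : mu (B n) = mu H by exact: lebesgue_rV_translate.
have fH : mu H \is a fin_num.
  rewrite ge0_fin_numE//; apply: le_lt_trans (measure_box_lty a b).
  by apply: le_lebesgue_rV; exact: subIsetl.
apply/eqP; rewrite eq_le measure_ge0 andbT.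
rewrite -(fineK fH) lee_fin leNgt; apply/negP => eps0.
pose eps := fine (mu H).
have vol0 : 0 <= box_volume a (b + one).
  by apply: prodr_ge0 => i _; rewrite le_max lexx.
have bnd (n : nat) : n%:R * fine (mu H) <= box_volume a (b + one).
  rewrite -lee_fin; apply: le_trans (lebesgue_rV_box_le _ _).
  have <- : mu (\big[setU/set0]_(i < n) B i) = (n%:R * fine (mu H))%:E.
    rewrite measure_semi_additive_ord_I//; last 2 first.
    - exact: sub_trivIset tB.
    - by apply: bigsetU_measurable.
    rewrite (eq_bigr (fun=> mu H)) => [|i _]; last exact: muB.
    by rewrite -[in LHS](fineK fH) sumEFin sumr_const card_ord mulr_natl.
  apply: le_lebesgue_rV => x; rewrite -bigcup_mkord => -[i _]; exact: subB.
pose n := (Num.truncn (box_volume a (b + one) / eps)).+1.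
have : box_volume a (b + one) / eps < n%:R by exact: truncnS_gt.
by rewrite ltr_pdivrMr// ltNge bnd.
Qed.

End boxes.

(** * The choice of a direction *)

Section trig_lipschitz.
Context {R : realType}.

Lemma cos_sub_le (x y : R) : `|cos x - cos y| <= `|x - y|.
Proof.
wlog xy : x y / x <= y.
  by move=> h; have [/h//|/ltW/h] := leP x y; rewrite distrC [X in _ <= X -> _]distrC.
have [|c _ h] := @MVT_segment R cos (fun x => - sin x) x y xy (fun z _ => is_derive_cos z).
  by apply: continuous_subspaceT => z; exact: continuous_cos.
by rewrite distrC h normrM normrN distrC -[X in _ <= X]mul1r ler_wpM2r// sin_max.
Qed.

Lemma sin_sub_le (x y : R) : `|sin x - sin y| <= `|x - y|.
Proof.
have := cos_sub_le (x - pi / 2) (y - pi / 2).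
by rewrite !cosBpihalf (_ : x - pi / 2 - (y - pi / 2) = x - y)//; ring.
Qed.

End trig_lipschitz.

Section grid.
Context {R : realType}.

Lemma sum_mul_ord (n L : nat) (G : nat -> R) :
  \sum_(i < n * L) G i = \sum_(m < n) \sum_(a < L) G (m * L + a)%N.
Proof.
rewrite -(big_mkord xpredT G) big_nat_mul big_mkord; apply: eq_bigr => m _.
rewrite -{1}[(m * L)%N]add0n big_addn mulSn addnK big_mkord.
by apply: eq_bigr => a _; rewrite addnC.
Qed.

Lemma sum2_mul_ord (n L : nat) (G : nat -> nat -> R) :
  \sum_(i < n * L) \sum_(j < n * L) G i j =
  \sum_(m < n) \sum_(m' < n) \sum_(a < L) \sum_(a' < L)
    G (m * L + a)%N (m' * L + a')%N.
Proof.
rewrite (sum_mul_ord n L (fun i => \sum_(j < n * L) G i j)); apply: eq_bigr => m _.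
rewrite [RHS]exchange_big/=; apply: eq_bigr => a _.
by rewrite sum_mul_ord.
Qed.

(* [Psi n x y] stands for the squared Fourier transform at [(3(n+1), x, y)].  The
   average over [(s, t)] in [[0, 1]^2] is replaced by one over a fine grid of mesh
   [1 / L], the Lipschitz bound absorbing the change of mesh from [(n+1) / L] to
   [1 / L]. *)
Lemma grid_direction (Psi : nat -> R -> R -> R) (C Lam : R) (N : nat) :
  (forall n x y, 0 <= Psi n x y) -> 0 <= Lam ->
  (forall n x y x' y', `|Psi n x y - Psi n x' y'| <= Lam * (`|x - x'| + `|y - y'|)) ->
  (forall al be, \sum_(n < N) \sum_(m < N) \sum_(l < N)
     Psi n (m%:R + al) (l%:R + be) <= C) ->
  exists s t, [/\ 0 <= s <= 1, 0 <= t <= 1 &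
    \sum_(n < N) n.+1%:R ^+ 2 * Psi n (n.+1%:R * s) (n.+1%:R * t) <= C + 1].
Proof.
move=> P0 Lam0 PL PC.
(* The change of mesh costs [c / L] at each grid point, less than the slack 1 in the bound [C + 1]
   once [c < L]. *)
pose c := \sum_(n < N) 2 * Lam * n.+1%:R ^+ 3.
pose L := (Num.truncn c).+1.
have cL : c < L%:R by exact: truncnS_gt.
have L0 : 0 < L%:R :> R by rewrite ltr0n.
have Ln0 : L%:R != 0 :> R by rewrite gt_eqF.
pose Phi s t := \sum_(n < N) n.+1%:R ^+ 2 * Psi n (n.+1%:R * s) (n.+1%:R * t).
pose G n (i j : nat) := Psi n (i%:R / L%:R) (j%:R / L%:R).
apply: contrapT => noex.
have big (j k : 'I_L) : C + 1 <= Phi (j%:R / L%:R) (k%:R / L%:R).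
  rewrite leNgt; apply/negP => h; apply: noex.
  exists (j%:R / L%:R), (k%:R / L%:R); split; last exact: ltW.
  - by rewrite divr_ge0//= ler_pdivrMr// mul1r ler_nat ltnW.
  - by rewrite divr_ge0//= ler_pdivrMr// mul1r ler_nat ltnW.
have term (n : 'I_N) (j k : 'I_L) :
    n.+1%:R ^+ 2 * Psi n (n.+1%:R * (j%:R / L%:R)) (n.+1%:R * (k%:R / L%:R)) <=
    \sum_(i < n.+1) \sum_(i' < n.+1) G n (j * n.+1 + i)%N (k * n.+1 + i')%N +
    2 * Lam * n.+1%:R ^+ 3 / L%:R.
  set p := Psi _ _ _.
  have one (i i' : 'I_n.+1) : p <=
      G n (j * n.+1 + i)%N (k * n.+1 + i')%N + 2 * Lam * n.+1%:R / L%:R.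
    rewrite -lerBlDl; apply: le_trans (ler_norm _) _; apply: le_trans (PL _ _ _ _ _) _.
    have E (x : 'I_L) (y : 'I_n.+1) :
        `|n.+1%:R * (x%:R / L%:R) - (x * n.+1 + y)%N%:R / L%:R| <= n.+1%:R / L%:R :> R.
      rewrite [X in `|X|](_ : _ = - (y%:R / L%:R)); last by rewrite natrD natrM; field.
      rewrite normrN ger0_norm ?divr_ge0//.
      by rewrite ler_pM2r ?invr_gt0// ler_nat ltnW.
    rewrite [leRHS](_ : _ = Lam * (n.+1%:R / L%:R + n.+1%:R / L%:R)); last by ring.
    by rewrite ler_wpM2l//; apply: lerD; exact: E.
  have -> : n.+1%:R ^+ 2 * p = \sum_(i < n.+1) \sum_(i' < n.+1) p.
    by rewrite !sumr_const !card_ord -mulrnA -[RHS]mulr_natl natrM -?expr2.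
  have -> : 2 * Lam * n.+1%:R ^+ 3 / L%:R =
      \sum_(i < n.+1) \sum_(i' < n.+1) (2 * Lam * n.+1%:R / L%:R).
    by rewrite !sumr_const !card_ord -mulrnA -[RHS]mulr_natl natrM; ring.
  rewrite -big_split; apply: ler_sum => i _.
  by rewrite -big_split; apply: ler_sum => i' _; exact: one.
have total : \sum_(j < L) \sum_(k < L) Phi (j%:R / L%:R) (k%:R / L%:R) <=
    L%:R ^+ 2 * C + L%:R * c.
  have -> : L%:R * c = \sum_(j < L) \sum_(k < L) \sum_(n < N)
      (2 * Lam * n.+1%:R ^+ 3 / L%:R).
    rewrite -mulr_suml -/c !sumr_const !card_ord -mulrnA -[RHS]mulr_natl natrM.
    by field.
  apply: (@le_trans _ _ (\sum_(j < L) \sum_(k < L) \sum_(n < N)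
      (\sum_(i < n.+1) \sum_(i' < n.+1) G n (j * n.+1 + i)%N (k * n.+1 + i')%N +
    2 * Lam * n.+1%:R ^+ 3 / L%:R))).
    by apply: ler_sum => j _; apply: ler_sum => k _; apply: ler_sum => n _; exact: term.
  under eq_bigr do under eq_bigr do rewrite big_split.
  under eq_bigr do rewrite big_split.
  rewrite big_split lerD2r.
  (* Both [j * n.+1 + i] and [m * L + a] enumerate the integers below [n.+1 * L]: the points of mesh
     [1 / L] in [[0, n.+1[], grouped by grid direction on one side and by unit interval and offset
     on the other. This is the tiling by unit squares. *)
  have -> : \sum_(j < L) \sum_(k < L) \sum_(n < N)
       \sum_(i < n.+1) \sum_(i' < n.+1) G n (j * n.+1 + i)%N (k * n.+1 + i')%N =
     \sum_(n < N) \sum_(m < n.+1) \sum_(m' < n.+1) \sum_(a < L) \sum_(a' < L)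
       G n (m * L + a)%N (m' * L + a')%N.
    under eq_bigr do rewrite exchange_big.
    rewrite exchange_big; apply: eq_bigr => n _.
    by rewrite -(sum2_mul_ord L n.+1 (G n)) mulnC sum2_mul_ord.
  have -> : L%:R ^+ 2 * C = \sum_(a < L) \sum_(a' < L) C.
    by rewrite !sumr_const !card_ord -mulrnA -[RHS]mulr_natl natrM -?expr2.
  apply: (@le_trans _ _ (\sum_(a < L) \sum_(a' < L) \sum_(n < N) \sum_(m < N)
     \sum_(m' < N) Psi n (m%:R + a%:R / L%:R) (m'%:R + a'%:R / L%:R))); last first.
    by apply: ler_sum => a _; apply: ler_sum => a' _; exact: PC.
  under [leRHS]eq_bigr do rewrite exchange_big.
  rewrite [leRHS]exchange_big; apply: ler_sum => n _.
  under [leRHS]eq_bigr do rewrite exchange_big.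
  rewrite [leRHS]exchange_big.
  have le1 (F : nat -> R) : (forall m, 0 <= F m) ->
      \sum_(m < n.+1) F m <= \sum_(m < N) F m.
    move=> F0; rewrite -!(big_mkord xpredT F) [leRHS](@big_cat_nat _ _ _ n.+1)//=.
    by rewrite lerDl sumr_ge0.
  pose H (m : nat) := \sum_(a < L) \sum_(a' < L) \sum_(m' < N)
    Psi n (m%:R + a%:R / L%:R) (m'%:R + a'%:R / L%:R).
  apply: (le_trans _ (le1 H _)); last first.
    by move=> m; do 3 (apply: sumr_ge0 => ? _); exact: P0.
  apply: ler_sum => m _; rewrite /H.
  under [leRHS]eq_bigr do rewrite exchange_big.
  rewrite [leRHS]exchange_big/=.
  pose H' (m' : nat) := \sum_(a < L) \sum_(a' < L)
    Psi n (m%:R + a%:R / L%:R) (m'%:R + a'%:R / L%:R).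
  apply: (le_trans _ (le1 H' _)); last first.
    by move=> m''; do 2 (apply: sumr_ge0 => ? _); exact: P0.
  apply: ler_sum => m' _; rewrite /H'.
  apply: ler_sum => a _; apply: ler_sum => a' _.
  by rewrite /G !natrD !natrM !mulrDl !mulfK.
have : \sum_(j < L) \sum_(k < L) (C + 1) <= L%:R ^+ 2 * C + L%:R * c.
  by apply: le_trans total; apply: ler_sum => j _; apply: ler_sum => k _; exact: big.
rewrite !sumr_const !card_ord -mulrnA -[leLHS]mulr_natl natrM -expr2 mulrDr mulr1 lerD2l.
by rewrite expr2 ler_pM2l// leNgt cL.
Qed.

(** One direction must serve all [N]. Take a cluster point in the compact square of the directions
    obtained for each [N]: the partial sums increase with [N], so the bound for [M >= N] bounds
    [Phi N] at the [M]-th direction, and [Phi N] is continuous. *)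
Lemma good_direction (Psi : nat -> R -> R -> R) (C Lam : R) :
  (forall n x y, 0 <= Psi n x y) -> 0 <= Lam ->
  (forall n x y x' y', `|Psi n x y - Psi n x' y'| <= Lam * (`|x - x'| + `|y - y'|)) ->
  (forall N al be, \sum_(n < N) \sum_(m < N) \sum_(l < N)
     Psi n (m%:R + al) (l%:R + be) <= C) ->
  exists s t, [/\ 0 <= s <= 1, 0 <= t <= 1 & forall N,
    \sum_(n < N) n.+1%:R ^+ 2 * Psi n (n.+1%:R * s) (n.+1%:R * t) <= C + 1].
Proof.
move=> P0 Lam0 PL PC.
pose Phi N (p : R * R) :=
  \sum_(n < N) n.+1%:R ^+ 2 * Psi n (n.+1%:R * p.1) (n.+1%:R * p.2).
pose K := `[0, 1]%classic `*` `[0, 1]%classic : set (R * R).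
have /choice[p pP] : forall N, exists p : R * R, K p /\ Phi N p <= C + 1.
  move=> N; have [s [t [s01 t01 h]]] := grid_direction P0 Lam0 PL (PC N).
  by exists (s, t); split => //; split; rewrite /= in_itv.
have cK : compact K by apply: compact_setX; exact: segment_compact.
have PhiS N M q : (N <= M)%N -> Phi N q <= Phi M q.
  move=> NM; pose F n := n.+1%:R ^+ 2 * Psi n (n.+1%:R * q.1) (n.+1%:R * q.2).
  rewrite /Phi -!(big_mkord xpredT F) [leRHS](@big_cat_nat _ _ _ N)//= lerDl.
  by rewrite sumr_ge0// => i _; rewrite mulr_ge0.
have [q [Kq clq]] : K `&` cluster (p @ \oo) !=set0.
  by apply: cK; exists 0%N => // n _; exact: (pP n).1.
exists q.1, q.2; case: Kq => /=; rewrite !in_itv/= => q1 q2; split=> // N.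
rewrite -/(Phi N q); apply/ler_addgt0Pr => eps eps0.
(* The sum is a Lipschitz constant of [Phi N] for the sup distance; the 1 makes it positive. *)
pose B := 1 + \sum_(n < N) n.+1%:R ^+ 2 * (Lam * (2 * n.+1%:R)).
have B0 : 0 < B.
  rewrite ltr_pwDl// sumr_ge0// => n _.
  by rewrite mulr_ge0// mulr_ge0// mulr_ge0.
have d0 : 0 < eps / B by rewrite divr_gt0.
have [r [[M NM <-] /= [b1 b2]]] := clq [set p M | M in [set M | (N <= M)%N]] (ball q (eps / B))
  (ltac:(by exists N => // M /= NM; exists M)) (nbhsx_ballx q _ d0).
have {}b1 : `|q.1 - (p M).1| < eps / B by exact: b1.
have {}b2 : `|q.2 - (p M).2| < eps / B by exact: b2.
have : Phi N q - Phi N (p M) <= eps.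
  apply: (@le_trans _ _ (B * (eps / B))); last by rewrite mulrC divfK// gt_eqF.
  rewrite /B mulrDl mul1r ler_wpDl//; first exact: ltW.
  rewrite mulr_suml -sumrB; apply: ler_sum => n _.
  rewrite -mulrBr -mulrA ler_wpM2l//.
  apply: le_trans (ler_norm _) _; apply: le_trans (PL _ _ _ _ _) _.
  rewrite -mulrA ler_wpM2l// -!mulrBr !normrM normr_nat -mulrDr -/B.
  rewrite -mulrA mulrCA ler_wpM2l// mulr_natl mulr2n.
  by apply: lerD; exact: ltW.
rewrite lerBlDl => /le_trans; apply; rewrite lerD2r.
by apply: le_trans (pP M).2; exact: PhiS.
Qed.

End grid.

Lemma Rintegral_norm_le {dT} {T : measurableType dT} {R : realType}
    (mu : {measure set T -> \bar R}) (D : set T) (f : T -> R) (c : R) :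
  measurable D -> (mu D < +oo)%E -> measurable_fun D f ->
  (forall x, D x -> `|f x| <= c) ->
  `|\int[mu]_(x in D) f x| <= c * fine (mu D).
Proof.
move=> mD muD mf fc.
have intf : mu.-integrable D (EFin \o f).
  by apply: bounded_measurable_integrable => //; split => //; exists c.
apply: le_trans (le_normr_Rintegral mD intf) _.
rewrite -Rintegral_cst//; apply: le_Rintegral => //.
- apply: bounded_measurable_integrable => //; split; first exact: measurableT_comp.
  by exists c => x Dx; rewrite normr_id fc.
- apply: bounded_measurable_integrable => //; split; first exact: measurable_cst.
  by exists `|c|.
Qed.

(** * Fourier transform of a bounded set along three coordinates *)

Section direction.
Context {R : realType} {d : nat}.
Local Notation V := 'rV[R]_d.+1.
Local Notation T := (@rV_type R d).
Local Notation mu := (@rV_measure R d).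

Definition cube (P : R) : set V := box (const_mx (- (P / 2))) (const_mx (P / 2)).

Lemma cube_norm_le P (x : V) q : cube P x -> `|x 0 q| <= P / 2.
Proof. by move=> /(_ q); rewrite !mxE ler_norml => /andP[/ltW -> ->]. Qed.

Variables (i j k : 'I_d.+1).
Hypotheses (ij : i != j) (ik : i != k) (jk : j != k).

Definition form3 (x y z : R) (v : V) : R := x * v 0 i + y * v 0 j + z * v 0 k.

Definition coef3 (x y z : R) (q : 'I_d.+1) : R :=
  x * (q == i)%:R + y * (q == j)%:R + z * (q == k)%:R.

Lemma form3E x y z : form3 x y z = linear_form (coef3 x y z).
Proof.
have pick (c : R) (p : 'I_d.+1) (v : V) : \sum_q c * (q == p)%:R * v 0 q = c * v 0 p.
  rewrite (bigD1 p)//= eqxx mulr1 big1 ?addr0// => q /negbTE ->.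
  by rewrite mulr0 mul0r.
apply/funext => v; rewrite /linear_form /coef3.
under eq_bigr do rewrite !mulrDl.
by rewrite !big_split/= !pick.
Qed.

Lemma coef3_i x y z : coef3 x y z i = x.
Proof. by rewrite /coef3 eqxx (negbTE ij) (negbTE ik) !mulr0 !addr0 mulr1. Qed.

Lemma coef3_j x y z : coef3 x y z j = y.
Proof. by rewrite /coef3 eqxx eq_sym (negbTE ij) (negbTE jk) !mulr0 addr0 add0r mulr1. Qed.

Lemma coef3_k x y z : coef3 x y z k = z.
Proof.
by rewrite /coef3 eqxx ![k == _]eq_sym (negbTE ik) (negbTE jk) !mulr0 !add0r mulr1.
Qed.

Lemma measurable_form3 x y z : measurable_fun [set: T] (form3 x y z : T -> R).
Proof. by rewrite form3E; exact: measurable_linear_form. Qed.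

Lemma measurable_cos_form3 x y z :
  measurable_fun [set: T] ((fun v => cos (form3 x y z v)) : T -> R).
Proof.
apply: (@continuous_comp_measurable _ _ cos); [exact: continuous_cos|exact: measurable_form3].
Qed.

Lemma measurable_sin_form3 x y z :
  measurable_fun [set: T] ((fun v => sin (form3 x y z v)) : T -> R).
Proof.
apply: (@continuous_comp_measurable _ _ sin); [exact: continuous_sin|exact: measurable_form3].
Qed.

Variables (P : R) (E : set V).
Hypotheses (P0 : 0 < P) (mE : measurable (E : set T)) (EQ : E `<=` cube P)
  (pE : (0 < mu E)%E).
Let w := 2 * pi / P.

Let EQT : (mu E < +oo)%E.
Proof. by apply: le_lt_trans (le_lebesgue_rV EQ) _; exact: measure_box_lty. Qed.

(* The squared modulus of the Fourier transform of [E] at [(x, y, z)]. *)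
Definition energy (x y z : R) : R :=
  (\int[mu]_(v in E) cos (form3 x y z v)) ^+ 2 +
  (\int[mu]_(v in E) sin (form3 x y z v)) ^+ 2.

(** [E] lies in a cube of side [P], so the phases move by at most [w * (P / 2) = pi] times the
    change of the parameters; differences of squares are then factored. *)
Lemma energy_lipschitz x y z y' z' :
  `|energy (w * x) (w * y) (w * z) - energy (w * x) (w * y') (w * z')| <=
    4 * pi * fine (mu E) ^+ 2 * (`|y - y'| + `|z - z'|).
Proof.
set S := `|_| + `|_|.
have m0 : 0 <= fine (mu E) by apply: fine_ge0; exact: measure_ge0.
have w0 : 0 <= w by rewrite divr_ge0 ?mulr_ge0 ?pi_ge0// ltW.
pose u := form3 (w * x) (w * y) (w * z); pose u' := form3 (w * x) (w * y') (w * z').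
have uu v : E v -> `|u v - u' v| <= pi * S.
  move=> /EQ Qv.
  have -> : u v - u' v = w * ((y - y') * v 0 j + (z - z') * v 0 k).
    by rewrite /u /u' /form3; ring.
  have -> : pi * S = w * (`|y - y'| * (P / 2) + `|z - z'| * (P / 2)).
    by rewrite /w /S; field; rewrite gt_eqF.
  rewrite normrM ger0_norm// ler_wpM2l//; apply: le_trans (ler_normD _ _) _.
  by apply: lerD; rewrite normrM ler_wpM2l//; exact: cube_norm_le.
have sq (f : R -> R) : continuous f -> (forall x, `|f x| <= 1) ->
    (forall x y, `|f x - f y| <= `|x - y|) ->
    `|(\int[mu]_(v in E) f (u v)) ^+ 2 - (\int[mu]_(v in E) f (u' v)) ^+ 2| <=
    2 * pi * fine (mu E) ^+ 2 * S.
  move=> cf f1 fL.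
  have mu_ : measurable_fun setT ((fun v => f (u v)) : T -> R).
    exact: (continuous_comp_measurable cf (measurable_form3 _ _ _)).
  have mu'_ : measurable_fun setT ((fun v => f (u' v)) : T -> R).
    exact: (continuous_comp_measurable cf (measurable_form3 _ _ _)).
  have b1 : bounded_measurable (E : set T) ((fun v => f (u v)) : T -> R).
    by split; [exact: measurable_funTS|exists 1].
  have b2 : bounded_measurable (E : set T) ((fun v => f (u' v)) : T -> R).
    by split; [exact: measurable_funTS|exists 1].
  rewrite subr_sqr normrM.
  have -> : 2 * pi * fine (mu E) ^+ 2 * S = (pi * S * fine (mu E)) * (2 * fine (mu E)).
    by ring.
  apply: ler_pM => //.
    rewrite -(pfB (Rintegral_positive_functional mE EQT) b1 b2).
    apply: (Rintegral_norm_le mE EQT) => [|v /uu].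
      exact: (measurable_funB b1.1 b2.1).
    by apply: le_trans; exact: fL.
  apply: le_trans (ler_normD _ _) _; rewrite mulr_natl mulr2n -[X in _ <= X + X]mul1r.
  apply: lerD.
    exact: (Rintegral_norm_le mE EQT b1.1).
  exact: (Rintegral_norm_le mE EQT b2.1).
have hc := sq _ (@continuous_cos R) (@cos_max R) cos_sub_le.
have hs := sq _ (@continuous_sin R) (@sin_max R) sin_sub_le.
rewrite /energy opprD addrACA; apply: le_trans (ler_normD _ _) _.
apply: le_trans (lerD hc hs) _.
by rewrite le_eqVlt; apply/orP; left; apply/eqP; ring.
Qed.

Let coef_eq (p : 'I_d.+1) (z z' : int) (x : R) : z != z' -> x = w * (z - z')%:~R ->
  `|x| * ((const_mx (P / 2) : V) 0 p - (const_mx (- (P / 2)) : V) 0 p) =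
   pi *+ (absz (z - z')).*2.
Proof.
move=> zz ->; rewrite !mxE opprK -splitr normrM ger0_norm; last first.
  by rewrite divr_ge0 ?mulr_ge0 ?pi_ge0// ltW.
rewrite -intr_norm -abszE -pmulrn -[RHS]mulr_natr -muln2 natrM.
by rewrite /w; field; rewrite gt_eqF.
Qed.

(** The frequencies differ by integer multiples of [w] in each coordinate, the offsets [al] and [be]
    cancelling. Distinct triples differ in some coordinate, and [Rintegral_box_trig] along it gives
    orthogonality on the cube; Bessel's inequality is applied to the indicator of [E]. *)
Lemma energy_sum_le (N : nat) (al be : R) :
  \sum_(n < N) \sum_(m < N) \sum_(l < N)
    energy (w * (3 * n.+1%:R)) (w * (m%:R + al)) (w * (l%:R + be)) <=
  fine (mu (cube P)) * fine (mu E).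
Proof.
have mQ : measurable (cube P : set T) by exact: measurable_box.
have Qoo : (mu (cube P) < +oo)%E by exact: measure_box_lty.
have Qfin : mu (cube P) \is a fin_num by rewrite ge0_fin_numE.
have V0 : 0 < fine (mu (cube P)).
  by rewrite fine_gt0// Qoo andbT (lt_le_trans pE)//; exact: le_lebesgue_rV.
have QE : (E : set T) = cube P `&` E by rewrite setIC; apply/esym/setIidPl.
have onE (g : T -> R) :
    \int[mu]_(v in cube P) (\1_E v * g v) = \int[mu]_(v in E) g v.
  rewrite [in RHS]QE Rintegral_mkcondr; apply: eq_Rintegral => v _.
  by rewrite patchE indicE; case: (v \in E); rewrite ?mul1r ?mul0r.
pose u (n : 'I_N * 'I_N * 'I_N) : T -> R :=
  form3 (w * (3 * n.1.1.+1%:R)) (w * (n.1.2%:R + al)) (w * (n.2%:R + be)).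
have pf := Rintegral_positive_functional mQ Qoo.
pose kd (n n' : 'I_N * 'I_N * 'I_N) := coef3
    (w * (3 * n.1.1.+1%:R) - w * (3 * n'.1.1.+1%:R))
    (w * (n.1.2%:R + al) - w * (n'.1.2%:R + al))
    (w * (n.2%:R + be) - w * (n'.2%:R + be)).
have uB n n' v : u n v - u n' v = linear_form (kd n n') v.
  by rewrite -form3E /u /form3; ring.
have orth n n' : n != n' ->
    \int[mu]_(v in cube P) cos (u n v - u n' v) = 0 /\
    \int[mu]_(v in cube P) sin (u n v - u n' v) = 0.
  move=> nn'.
  have -> : \int[mu]_(v in cube P) cos (u n v - u n' v) =
      \int[mu]_(v in cube P) cos (linear_form (kd n n') v).
    by apply: eq_Rintegral => v _; rewrite uB.
  have -> : \int[mu]_(v in cube P) sin (u n v - u n' v) =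
      \int[mu]_(v in cube P) sin (linear_form (kd n n') v).
    by apply: eq_Rintegral => v _; rewrite uB.
  have ab p : (const_mx (- (P / 2)) : V) 0 p < (const_mx (P / 2) : V) 0 p.
    by rewrite !mxE gtrN// divr_gt0.
  have [n1|n1] := eqVneq n.1.1 n'.1.1; last first.
    have zz : ((3 * n.1.1.+1)%:Z != (3 * n'.1.1.+1)%:Z)%R.
      by rewrite eqz_nat eqn_mul2l/= eqSS.
    apply: (Rintegral_box_trig _ (ab i)); last first.
      rewrite /kd coef3_i; apply: (coef_eq _ zz); rewrite -mulrBr rmorphB/=.
      by rewrite -!pmulrn !natrM.
    by rewrite absz_gt0 subr_eq0.
  have [n2|n2] := eqVneq n.1.2 n'.1.2; last first.
    have zz : (n.1.2%:Z != n'.1.2%:Z)%R by rewrite eqz_nat.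
    apply: (Rintegral_box_trig _ (ab j)); last first.
      rewrite /kd coef3_j; apply: (coef_eq _ zz); rewrite -mulrBr rmorphB/=.
      by rewrite -!pmulrn; congr (_ * _); ring.
    by rewrite absz_gt0 subr_eq0.
  have [n3|n3] := eqVneq n.2 n'.2; last first.
    have zz : (n.2%:Z != n'.2%:Z)%R by rewrite eqz_nat.
    apply: (Rintegral_box_trig _ (ab k)); last first.
      rewrite /kd coef3_k; apply: (coef_eq _ zz); rewrite -mulrBr rmorphB/=.
      by rewrite -!pmulrn; congr (_ * _); ring.
    by rewrite absz_gt0 subr_eq0.
  exfalso; move/eqP: nn'; apply; move: n1 n2 n3.
  by case: n n' => [[? ?] ?] [[? ?] ?] /= -> -> ->.
have := @bessel R T (bounded_measurable (cube P : set T)) _ pf _ u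
  (fine (mu (cube P))) (\1_E) V0.
rewrite onE.
rewrite (@eq_Rintegral _ T R mu _ (fun v => 1)); last first.
  by move=> v /set_mem Ev; rewrite indicE mem_set.
rewrite Rintegral_cst// mul1r => h.
apply: le_trans (h _ _ _ _ _); last 5 first.
- split; first by apply: measurable_funTS; exact: measurable_indic.
  by exists 1 => v _; rewrite indicE; case: (v \in E); rewrite ?normr0 ?normr1.
- move=> n; split; first by apply: measurable_funTS; exact: measurable_cos_form3.
  by exists 1 => v _; exact: cos_max.
- move=> n; split; first by apply: measurable_funTS; exact: measurable_sin_form3.
  by exists 1 => v _; exact: sin_max.
- move=> n n'; case: eqVneq => [->|/orth[]//].
  rewrite (@eq_Rintegral _ T R mu _ (fun v => 1)) ?Rintegral_cst ?mul1r// => v _.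
  by rewrite subrr cos0.
- move=> n n'; have [->|/orth[]//] := eqVneq n n'.
  rewrite (@eq_Rintegral _ T R mu _ (fun v => 0)) ?Rintegral_cst ?mul0r// => v _.
  by rewrite subrr sin0.
rewrite pair_big pair_big/= le_eqVlt; apply/orP; left; apply/eqP.
by apply: eq_bigr => -[[n m] l] _; rewrite /= !onE.
Qed.

Lemma exists_direction : exists s t C, [/\ 0 <= s <= 1, 0 <= t <= 1 & forall N,
  \sum_(n < N) n.+1%:R ^+ 2 *
   ((\int[mu]_(v in E) cos (n.+1%:R * w * form3 3 s t v)) ^+ 2 +
    (\int[mu]_(v in E) sin (n.+1%:R * w * form3 3 s t v)) ^+ 2) <= C].
Proof.
pose Psi n y z := energy (w * (3 * n.+1%:R)) (w * y) (w * z).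
have Psi0 n x y : 0 <= Psi n x y by rewrite addr_ge0// sqr_ge0.
have L0 : 0 <= 4 * pi * fine (mu E) ^+ 2 :> R.
  by rewrite mulr_ge0 ?sqr_ge0// mulr_ge0// pi_ge0.
have [s [t [s01 t01 h]]] := good_direction Psi0 L0
  (fun n x y x' y' => energy_lipschitz (3 * n.+1%:R) x y x' y') energy_sum_le.
exists s, t, (fine (mu (cube P)) * fine (mu E) + 1); split => // N.
apply: le_trans (h N); rewrite le_eqVlt; apply/orP; left; apply/eqP.
apply: eq_bigr => n _; rewrite /Psi /energy; congr (_ * (_ ^+ 2 + _ ^+ 2)).
  by apply: eq_Rintegral => v _; congr cos; rewrite /form3; ring.
by apply: eq_Rintegral => v _; congr sin; rewrite /form3; ring.
Qed.

End direction.

(** * Fejer kernel on a grid *)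

Section fejer.
Context {R : realType}.

Lemma sum_cos_progression (L : nat) (h be : R) :
  2 * sin h * \sum_(v < L) cos (v%:R * (2 * h) + be) =
  sin (L%:R * (2 * h) - h + be) - sin (be - h).
Proof.
elim: L => [|L IH]; first by rewrite big_ord0 mulr0 mul0r sub0r [- h + be]addrC subrr.
rewrite big_ord_recr mulrDr IH.
have -> : L.+1%:R * (2 * h) - h + be = L%:R * (2 * h) + be + h by rewrite -natr1; ring.
have -> : L%:R * (2 * h) - h + be = L%:R * (2 * h) + be - h by ring.
move: (L%:R * _ + be) => y /=; rewrite (sinD y h) (sinB y h); ring.
Qed.

Lemma sinDn2pi (n : nat) (x : R) : sin (x + n%:R * (2 * pi)) = sin x.
Proof.
rewrite -[RHS](periodicn (@sinD2pi R) n x); congr (sin (_ + _)).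
by rewrite mulr_natl; congr (_ *+ _); rewrite mulr_natl.
Qed.

(** For [h = n pi / L] the end terms of the telescoped sum differ by [n] full periods, and [sin h]
    is nonzero because [0 < h < pi]. *)
Lemma sum_cos_grid (L n : nat) (be : R) : (0 < n < L)%N ->
  \sum_(v < L) cos (n%:R * (2 * pi / L%:R * v%:R) + be) = 0.
Proof.
move=> /andP[n0 nL].
have L0 : 0 < L%:R :> R by rewrite ltr0n (leq_ltn_trans _ nL).
pose h : R := n%:R * pi / L%:R.
have h0 : 0 < h by rewrite divr_gt0// mulr_gt0 ?ltr0n// pi_gt0.
have hpi : h < pi by rewrite ltr_pdivrMr// mulrC ltr_pM2l ?pi_gt0// ltr_nat.
have sh : 2 * sin h != 0 by rewrite mulf_neq0// gt_eqF// sin_gt0_pi// h0.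
apply: (mulfI sh); rewrite mulr0 -[RHS](subrr (sin (be - h))).
rewrite -[X in _ = X - _](sinDn2pi n).
rewrite (_ : be - h + n%:R * (2 * pi) = L%:R * (2 * h) - h + be); last first.
  by rewrite /h; field; rewrite gt_eqF.
rewrite -sum_cos_progression; congr (_ * _); apply: eq_bigr => v _; congr (cos (_ + _)).
by rewrite /h; ring.
Qed.

Lemma sum_sin_grid (L n : nat) (be : R) : (0 < n < L)%N ->
  \sum_(v < L) sin (n%:R * (2 * pi / L%:R * v%:R) + be) = 0.
Proof.
move=> nL; rewrite -[RHS](sum_cos_grid (be - pi / 2) nL); apply: eq_bigr => v _.
by rewrite addrA cosBpihalf.
Qed.

(** The absolute difference, by truncated subtraction. As [cos] is even, it serves as the frequency
    attached to a pair of indices. *)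
Definition natdist (j k : nat) : nat := (j - k) + (k - j).

Lemma natdistE (j k : nat) : (natdist j k)%:R = `|j%:R - k%:R| :> R.
Proof.
rewrite /natdist; have [jk|/ltnW kj] := leqP j k.
  by rewrite (eqP jk) add0n natrB// distrC ger0_norm// subr_ge0 ler_nat.
by rewrite (eqP kj) addn0 natrB// ger0_norm// subr_ge0 ler_nat.
Qed.

Lemma natdist_eq0 j k : (natdist j k == 0)%N = (j == k).
Proof. by rewrite /natdist addn_eq0 !subn_eq0 -eqn_leq. Qed.

Lemma natdist_lt j k L : (j < L)%N -> (k < L)%N -> (natdist j k < L)%N.
Proof.
by move=> jL kL; rewrite /natdist; have [jk|/ltnW kj] := leqP j k;
  [rewrite (eqP jk) add0n|rewrite (eqP kj) addn0]; rewrite ltn_subLR// ltn_addl.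
Qed.

Lemma cos_natdist (j k : nat) (x : R) :
  cos ((natdist j k)%:R * x) = cos (j%:R * x - k%:R * x).
Proof.
rewrite natdistE -mulrBl; have [h|h] := leP 0 (j%:R - k%:R : R).
  by rewrite ger0_norm.
by rewrite ltr0_norm// mulNr cosN.
Qed.

(** For fixed [j], a given distance is attained by at most one [k <= j] and one [k > j]. *)
Lemma sum_natdist_le (L : nat) (h : nat -> R) : (forall n, 0 <= h n) ->
  \sum_(j < L) \sum_(k < L) h (natdist j k) <= 2 * L%:R * \sum_(n < L) h n.
Proof.
move=> h0.
have -> : 2 * L%:R * \sum_(n < L) h n = \sum_(j < L) (2 * \sum_(n < L) h n).
  by rewrite sumr_const card_ord -[RHS]mulr_natl; ring.
apply: ler_sum => j _; rewrite mulr_natl mulr2n.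
have extend n m : (n <= m)%N -> \sum_(i < n) h i <= \sum_(i < m) h i.
  move=> nm; rewrite -!(big_mkord xpredT h) [leRHS](@big_cat_nat _ _ _ n)//= lerDl.
  by rewrite sumr_ge0.
rewrite -(big_mkord xpredT (fun k => h (natdist j k))).
rewrite (@big_cat_nat _ _ _ j.+1)//=; apply: lerD.
  rewrite big_mkord (reindex_inj rev_ord_inj)/=.
  have rev (k : 'I_j.+1) : natdist j (rev_ord k) = k.
    have kj : (k <= j)%N by rewrite -ltnS.
    by rewrite /natdist /= subSS subKn// (eqP (_ : j - k - j == 0)%N) ?addn0// subn_eq0 leq_subr.
  rewrite (eq_bigr (fun k : 'I_j.+1 => h k)) => [|k _]; first exact: extend.
  by rewrite rev.
rewrite -{1}[j.+1]add0n big_addn big_mkord.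
apply: (@le_trans _ _ (\sum_(i < L - j.+1) h i.+1)).
  apply: ler_sum => i _; rewrite /natdist.
  rewrite (_ : (j - (i + j.+1) = 0)%N) ?add0n; last first.
    by apply/eqP; rewrite subn_eq0 addnS ltnW// ltnS leq_addl.
  by rewrite addnS -addSn addnK.
apply: (@le_trans _ _ (\sum_(i < (L - j.+1).+1) h i)).
  by rewrite big_ord_recl lerDr.
by apply: extend; rewrite subnSK ?leq_subr.
Qed.

(** The Fejer kernel [|sum_j exp(i j u)|^2 / L], expanded over pairs so that it is visibly a cosine
    polynomial with frequencies below [L]. *)
Definition fejer (L : nat) (u : R) : R :=
  L%:R^-1 * \sum_(j < L) \sum_(k < L) cos ((natdist j k)%:R * u).

Lemma fejerE L u : fejer L u =
  L%:R^-1 * ((\sum_(j < L) cos (j%:R * u)) ^+ 2 + (\sum_(j < L) sin (j%:R * u)) ^+ 2).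
Proof.
congr (_ * _); rewrite !expr2 !mulr_suml -big_split; apply: eq_bigr => j _.
rewrite !mulr_sumr -big_split; apply: eq_bigr => k _.
by rewrite cos_natdist cosB.
Qed.

Lemma fejer_ge0 L u : 0 <= fejer L u.
Proof. by rewrite fejerE mulr_ge0 ?invr_ge0// addr_ge0 ?sqr_ge0. Qed.

(** The telescoped progression bounds the cosine sum and the sine sum (phase [- pi / 2]) separately
    by [1 / |sin (u / 2)|], whence the factor 2. *)
Lemma fejer_le L u : (0 < L)%N -> sin (u / 2) != 0 ->
  fejer L u <= 2 / (L%:R * sin (u / 2) ^+ 2).
Proof.
move=> L0 s0; rewrite fejerE invfM mulrCA ler_wpM2l ?invr_ge0//.
have s20 : 0 < sin (u / 2) ^+ 2 by rewrite exprn_even_gt0.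
have two (x : R) : 2 * (x / 2) = x by rewrite mulrC divfK.
have aux be : (sin (u / 2) * \sum_(v < L) cos (v%:R * u + be)) ^+ 2 <= 1.
  have := sum_cos_progression L (u / 2) be; rewrite two => h.
  rewrite -(ler_pM2l (_ : 0 < 4))// (_ : 4 * _ = (2 * sin (u / 2) *
    \sum_(v < L) cos (v%:R * u + be)) ^+ 2); last by ring.
  rewrite h -[leLHS](real_normK (num_real _)) (_ : 4 * 1 = 2 ^+ 2); last by ring.
  rewrite ler_sqr ?nnegrE//; apply: le_trans (ler_normB _ _) _.
  by rewrite -[leRHS](_ : 1 + 1 = 2)//; apply: lerD; exact: sin_max.
have := aux 0; have := aux (- (pi / 2)).
under eq_bigr do rewrite cosBpihalf.
under [in X in _ -> X -> _]eq_bigr do rewrite addr0.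
rewrite !exprMn => h1 h2.
rewrite ler_pdivlMr// mulrC mulrDr -[leRHS](_ : 1 + 1 = 2)//.
exact: lerD.
Qed.

(** All frequencies of the kernel are below the number [L] of grid points, so the grid mean
    annihilates every pair off the diagonal. *)
Lemma fejer_mean L x : (0 < L)%N ->
  L%:R^-1 * \sum_(v < L) fejer L (x - 2 * pi / L%:R * v%:R) = 1.
Proof.
move=> L0; have Ln0 : L%:R != 0 :> R by rewrite pnatr_eq0 -lt0n.
rewrite /fejer -mulr_sumr exchange_big/=.
rewrite (eq_bigr (fun=> L%:R)) => [|j _]; last first.
  rewrite exchange_big/= (bigD1 j)//= [X in X + _](eq_bigr (fun=> 1)) => [|v _]; last first.
    by rewrite (eqP (_ : natdist j j == 0)%N) ?natdist_eq0// mul0r cos0.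
  rewrite sumr_const card_ord big1 ?addr0// => k kj.
  rewrite -[RHS](@sum_cos_grid L (natdist j k) (- ((natdist j k)%:R * x))).
    by apply: eq_bigr => v _; rewrite -cosN mulrBr opprB.
  by rewrite natdist_lt// andbT lt0n natdist_eq0 eq_sym.
by rewrite sumr_const card_ord -[L%:R *+ L]mulr_natr; field.
Qed.

Definition grid_cos (L : nat) (f : nat -> R) (n : nat) : R :=
  L%:R^-1 * \sum_(v < L) f v * cos (n%:R * (2 * pi / L%:R * v%:R)).

Definition grid_sin (L : nat) (f : nat -> R) (n : nat) : R :=
  L%:R^-1 * \sum_(v < L) f v * sin (n%:R * (2 * pi / L%:R * v%:R)).

Lemma grid_bessel (L : nat) (f : nat -> R) : (0 < L)%N -> (forall v, `|f v| <= 1) ->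
  \sum_(n < L) (grid_cos L f n ^+ 2 + grid_sin L f n ^+ 2) <= 1.
Proof.
move=> L0 f1; have Ln0 : L%:R != 0 :> R by rewrite pnatr_eq0 -lt0n.
pose J (g : 'I_L -> R) := L%:R^-1 * \sum_v g v.
have pf : positive_functional [set: 'I_L -> R] J.
  split => //.
  - by move=> g h _ _; rewrite /J big_split mulrDr.
  - by move=> c g _; rewrite /J -mulr_sumr mulrCA.
  - by move=> g _ g0; rewrite /J mulr_ge0 ?invr_ge0// sumr_ge0.
pose u (n v : 'I_L) : R := n%:R * (2 * pi / L%:R * v%:R).
have Jc n m : J (fun v => cos (u n v - u m v)) = if n == m then 1 else 0.
  rewrite /J; under eq_bigr do rewrite /u -cos_natdist.
  case: eqVneq => [->|nm].
    under eq_bigr do rewrite (eqP (_ : natdist m m == 0)%N) ?natdist_eq0// mul0r cos0.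
    by rewrite sumr_const card_ord mulVf.
  under eq_bigr do rewrite -[X in cos X]addr0.
  by rewrite sum_cos_grid ?mulr0// natdist_lt// andbT lt0n natdist_eq0.
have Js n m : J (fun v => sin (u n v - u m v)) = 0.
  rewrite /J; have [nm|mn|/val_inj ->] := ltngtP n m.
  - rewrite (eq_bigr (fun v : 'I_L => - sin ((m - n)%:R * (2 * pi / L%:R * v%:R) + 0))).
      rewrite sumrN sum_sin_grid ?oppr0 ?mulr0// subn_gt0 nm/=.
      by apply: leq_ltn_trans (ltn_ord m); exact: leq_subr.
    by move=> v _; rewrite addr0 -sinN natrB 1?ltnW// /u; congr sin; ring.
  - rewrite (eq_bigr (fun v : 'I_L => sin ((n - m)%:R * (2 * pi / L%:R * v%:R) + 0))).
      rewrite sum_sin_grid ?mulr0// subn_gt0 mn/=.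
      by apply: leq_ltn_trans (ltn_ord n); exact: leq_subr.
    by move=> v _; rewrite addr0 natrB 1?ltnW// /u; congr sin; ring.
  - by rewrite big1 ?mulr0// => v _; rewrite subrr sin0.
have := bessel pf (f := fun v => f v) ltr01 I (fun _ => I) (fun _ => I) Jc Js.
move/le_trans; apply; rewrite mul1r /J.
rewrite -[leRHS](mulVf Ln0) ler_wpM2l ?invr_ge0//.
rewrite -[L in L%:R]card_ord -sumr_const; apply: ler_sum => v _.
by rewrite -expr2 -(real_normK (num_real _)) expr_le1.
Qed.

End fejer.

(** * Pairing with a square-summable sequence *)

Lemma nonneg_series_tail {R : realType} (x : nat -> R) (C eta : R) :
  (forall n, 0 <= x n) -> (forall N, \sum_(n < N) x n <= C) -> 0 < eta ->
  exists N0, forall N, \sum_(n < N | (N0 <= n)%N) x n <= eta.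
Proof.
move=> x0 xC eta0.
pose S N := \sum_(n < N) x n.
have ndS : nondecreasing_seq S.
  move=> m n mn; rewrite /S -!(big_mkord xpredT x) [leRHS](@big_cat_nat _ _ _ m)//= lerDl.
  by rewrite sumr_ge0.
have cS : cvgn S.
  by apply: nondecreasing_is_cvgn => //; exists C => _ [n _ <-]; exact: xC.
have [N0 _ hN0] : \forall n \near \oo, limn S - eta <= S n.
  by near=> n; near: n; apply: (cvgr_ge (limn S)) => //; rewrite gtrBl.
exists N0 => N; have [NN0|/ltnW N0N] := leqP N N0.
  rewrite big_pred0 ?ltW// => n; apply/negbTE; rewrite -ltnNge.
  exact: leq_trans (ltn_ord n) NN0.
have := hN0 N0 (leqnn _); rewrite lerBlDr => h.
have SN : S N <= limn S by exact: nondecreasing_cvgn_le.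
have {SN h} := le_trans SN h.
rewrite /S (bigID (fun n : 'I_N => (N0 <= n)%N))/= addrC.
rewrite (eq_bigl (fun n : 'I_N => (n < N0)%N)); last by move=> n; rewrite -ltnNge.
by rewrite -(big_ord_widen _ x N0N) lerD2l.
Unshelve. all: by end_near. Qed.

(** Low frequencies are controlled by the smallness of [y], high ones by the tail of [x]. [N0] and
    [delta] depend on [x] alone, so [y] may be constructed afterwards. *)
Lemma sum_mul_le_tail {R : realType} (x : nat -> R) (C eps : R) :
  (forall n, 0 <= x n) -> (forall N, \sum_(n < N) x n ^+ 2 <= C) -> 0 < eps ->
  exists (N0 : nat) (delta : R), 0 < delta /\ forall N (y : nat -> R),
    (forall n, 0 <= y n) -> \sum_(n < N) y n ^+ 2 <= 2 ->
    (forall n, (n < N0)%N -> y n <= delta) ->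
    \sum_(n < N) x n * y n <= eps.
Proof.
move=> x0 xC eps0.
(* The weight in [x y <= lam / 2 * x ^ 2 + y ^ 2 / (2 * lam)]: the bound 2 on the squares of [y]
   then costs [eps / 4], and so does a tail of [x ^ 2] below [eps / (2 * lam)]. *)
pose lam := 4 / eps.
have lam0 : 0 < lam by rewrite divr_gt0.
have [||N0 tail] := @nonneg_series_tail R (fun n => x n ^+ 2) C (eps / (2 * lam)) _ xC.
- by move=> n; exact: sqr_ge0.
- by rewrite divr_gt0// mulr_gt0.
pose G := 1 + \sum_(n < N0) x n.
have G0 : 0 < G by rewrite ltr_pwDl// sumr_ge0.
exists N0, (eps / (2 * G)); split; first by rewrite divr_gt0// mulr_gt0.
move=> N z z0 z2 zd.
rewrite (bigID (fun n : 'I_N => (n < N0)%N))/=.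
rewrite -[leRHS](_ : eps / 2 + eps / 2 = eps); last by rewrite -splitr.
apply: lerD.
  apply: (@le_trans _ _ (\sum_(n < N | (n < N0)%N) x n * (eps / (2 * G)))).
    by apply: ler_sum => n nN0; rewrite ler_wpM2l// zd.
  rewrite -mulr_suml.
  rewrite -[leRHS](_ : G * (eps / (2 * G)) = _); last by field; rewrite gt_eqF.
  apply: ler_wpM2r; first by rewrite divr_ge0 ?ltW// mulr_gt0.
  rewrite /G ler_wpDl//.
  have [NN0|/ltnW N0N] := leqP N N0; last by rewrite -(big_ord_widen _ x N0N).
  rewrite [leLHS](_ : _ = \sum_(i < N) x i); last first.
    by apply: eq_bigl => n; rewrite (leq_trans (ltn_ord n)).
  rewrite (big_ord_widen N0 x NN0) [leRHS](bigID (fun i : 'I_N0 => (i < N)%N))/= lerDl.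
  exact: sumr_ge0.
apply: (@le_trans _ _ (\sum_(n < N | ~~ (n < N0)%N)
  (lam / 2 * x n ^+ 2 + (2 * lam)^-1 * z n ^+ 2))).
  apply: ler_sum => n _; rewrite -subr_ge0.
  rewrite [leRHS](_ : _ = (lam * x n - z n) ^+ 2 / (2 * lam)); last by field; rewrite gt_eqF.
  by rewrite divr_ge0 ?sqr_ge0// mulr_ge0// ltW.
rewrite big_split/= -!mulr_sumr.
rewrite -[leRHS](_ : lam / 2 * (eps / (2 * lam)) + (2 * lam)^-1 * 2 = _); last first.
  by rewrite /lam; field; rewrite gt_eqF.
have l1 : 0 <= lam / 2 by apply/ltW/divr_gt0.
have l2 : 0 <= (2 * lam)^-1 by rewrite invr_ge0 mulr_ge0// ltW.
apply: lerD; apply: ler_wpM2l => //.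
  apply: le_trans (tail N); rewrite le_eqVlt; apply/orP; left; apply/eqP.
  by apply: eq_bigl => n; rewrite -leqNgt.
apply: le_trans z2; rewrite [leRHS](bigID (fun n : 'I_N => ~~ (n < N0)%N))/= lerDl.
by apply: sumr_ge0 => n _; exact: sqr_ge0.
Qed.

(** * Fejer means of sampled functions *)

Section fejer_approx.
Context {R : realType} (P : nat).
Hypothesis P0 : (0 < P)%N.
Local Notation w := (2 * pi / P%:R : R).

(** The grid of mesh [2 ^ - K] on [[0, P[]; being dyadic, it eventually subdivides the cells of the
    test set. *)
Definition gsize (K : nat) : nat := (P * 2 ^ K)%N.

Definition sample (e : R -> R) (K v : nat) : R := e (v%:R / (2 ^ K)%:R).

(* The number of grid points is also the degree of the kernel, so a single limit
   [K --> oo] is taken. *)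
Definition fejer_approx (e : R -> R) (K : nat) (r : R) : R :=
  (gsize K)%:R^-1 * \sum_(v < gsize K)
     sample e K v * fejer (gsize K) (w * r - 2 * pi / (gsize K)%:R * v%:R).

Lemma gsize_gt0 K : (0 < gsize K)%N.
Proof. by rewrite /gsize muln_gt0 P0 expn_gt0. Qed.

Let PR0 : 0 < P%:R :> R. Proof. by rewrite ltr0n. Qed.

Lemma grid_angle K (v : nat) :
  2 * pi / (gsize K)%:R * v%:R = w * (v%:R / (2 ^ K)%:R) :> R.
Proof.
rewrite /gsize natrM; field.
by rewrite !pnatr_eq0 -!lt0n expn_gt0 P0.
Qed.

Lemma fejer_approx_norm_le e K r : (forall x, `|e x| <= 1) -> `|fejer_approx e K r| <= 1.
Proof.
move=> e1; rewrite /fejer_approx normrM ger0_norm ?invr_ge0//.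
rewrite -[leRHS](fejer_mean (w * r) (gsize_gt0 K)) ler_wpM2l ?invr_ge0//.
apply: le_trans (ler_norm_sum _ _ _) _; apply: ler_sum => v _.
rewrite normrM (ger0_norm (fejer_ge0 _ _)) -[leRHS]mul1r.
by apply: ler_wpM2r; [exact: fejer_ge0|exact: e1].
Qed.

Lemma sin_ge_center (h y : R) : 0 <= h -> h <= y <= pi - h -> sin h <= sin y.
Proof.
move=> h0 /andP[hy yh].
have aux z : h <= z -> z <= pi / 2 -> sin h <= sin z.
  move=> hz zp; have p0 : 0 <= pi / 2 :> R by rewrite divr_ge0// pi_ge0.
  have zI : z \in `[(- (pi / 2)), pi / 2] by rewrite in_itv/=; apply/andP; split; lra.
  have hI : h \in `[(- (pi / 2)), pi / 2] by rewrite in_itv/=; apply/andP; split; lra.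
  by rewrite leNgt ltr_sin// -leNgt.
have [yp|/ltW yp] := leP y (pi / 2); first exact: aux.
have -> : sin y = sin (pi - y) by rewrite sinB sinpi cospi mul0r mulN1r sub0r opprK.
by apply: aux; lra.
Qed.

Lemma fejer_approx_cvg (e : R -> R) (r : R) : (forall x, `|e x| <= 1) -> 0 < r < P%:R ->
  {for r, continuous e} -> fejer_approx e K r @[K --> \oo] --> e r.
Proof.
move=> e1 /andP[r0 rP] ce; apply/cvgrPdist_le => eps eps0.
have eps20 : 0 < eps / 2 by rewrite divr_gt0.
have [del del0 hdel] : exists2 del, 0 < del & forall v, `|r - v| < del -> `|e r - e v| <= eps / 2.
  by move/cvgrPdist_le : ce => /(_ _ eps20)/nbhs_ballP[del del0 h]; exists del.
(* The kernel has period [P], so points near the opposite end of [[0, P[] are also close to [r] on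
   the circle. With [dl <= r] and [dl <= P - r], a distance of at least [dl] puts the half angle in
   [[h, pi - h]]. *)
pose dl := Num.min del (Num.min r (P%:R - r)).
have dl0 : 0 < dl by rewrite !lt_min del0 r0 subr_gt0 rP.
have [dl1 dl2 dl3] : [/\ dl <= del, dl <= r & dl <= P%:R - r].
  by rewrite /dl !ge_min !lexx !orbT.
have w0 : 0 < w by rewrite divr_gt0// mulr_gt0// pi_gt0.
pose h := w * dl / 2.
have h0 : 0 < h by rewrite divr_gt0// mulr_gt0.
have hpi : h < pi.
  rewrite -[ltRHS](_ : w * P%:R / 2 = pi); last by field; rewrite gt_eqF.
  by rewrite ltr_pM2r ?invr_gt0// ltr_pM2l//; lra.
have sh0 : 0 < sin h by rewrite sin_gt0_pi// h0.
pose s0 := sin h ^+ 2.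
have s00 : 0 < s0 by rewrite exprn_gt0.
near=> K; pose L := gsize K.
have L0 : 0 < L%:R :> R by rewrite ltr0n gsize_gt0.
(* This makes the kernel at most [2 / (L * s0) <= eps / 4] away from [r], where the samples differ
   from [e r] by at most 2. *)
have Ls : 8 / (s0 * eps) <= L%:R.
  apply: (@le_trans _ _ K%:R); first by near: K; exact: nbhs_infty_ger.
  rewrite ler_nat /L /gsize; apply: leq_trans (ltnW (ltn_expl K (ltnSn 1))) _.
  by rewrite leq_pmull.
rewrite distrC.
have -> : fejer_approx e K r - e r = L%:R^-1 * \sum_(v < L)
   (sample e K v - e r) * fejer L (w * r - 2 * pi / L%:R * v%:R).
  under eq_bigr do rewrite mulrBl.
  by rewrite sumrB mulrBr -mulr_sumr mulrCA fejer_mean ?gsize_gt0// mulr1.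
rewrite normrM ger0_norm ?invr_ge0//.
have term (v : 'I_L) :
    `|(sample e K v - e r) * fejer L (w * r - 2 * pi / L%:R * v%:R)| <=
    eps / 2 * fejer L (w * r - 2 * pi / L%:R * v%:R) + eps / 2.
  rewrite normrM (ger0_norm (fejer_ge0 _ _)).
  set F := fejer _ _; have F0 : 0 <= F by exact: fejer_ge0.
  pose y : R := v%:R / (2 ^ K)%:R.
  have [yr|yr] := ltP `|r - y| dl.
    apply: ler_wpDr; first exact: ltW.
    by rewrite ler_wpM2r// distrC hdel// (lt_le_trans yr).
  have y0 : 0 <= y by rewrite divr_ge0.
  have yP : y < P%:R.
    by rewrite ltr_pdivrMr ?ltr0n ?expn_gt0// -natrM ltr_nat.
  have E : sin ((w * r - 2 * pi / L%:R * v%:R) / 2) ^+ 2 = sin (w * `|r - y| / 2) ^+ 2.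
    rewrite grid_angle -/y -mulrBr; have [ry|ry] := leP 0 (r - y).
      by rewrite ger0_norm.
    by rewrite ltr0_norm// mulrN mulNr sinN sqrrN.
  have sE : s0 <= sin ((w * r - 2 * pi / L%:R * v%:R) / 2) ^+ 2.
    rewrite E /s0 ler_sqr ?nnegrE; last 2 first.
    - exact: ltW.
    - apply: sin_ge0_pi; apply/andP; split.
        by rewrite divr_ge0// mulr_ge0// ltW.
      rewrite -[leRHS](_ : w * P%:R / 2 = pi); last by field; rewrite gt_eqF.
      rewrite ler_pM2r ?invr_gt0// ler_pM2l// ler_norml; lra.
    apply: sin_ge_center; first exact: ltW.
    rewrite /h ler_pM2r ?invr_gt0// ler_pM2l// yr/=.
    rewrite -[X in _ <= X - _](_ : w * P%:R / 2 = pi); last by field; rewrite gt_eqF.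
    rewrite -mulrBl -mulrBr ler_pM2r ?invr_gt0// ler_pM2l// ler_norml; lra.
  have Fle : F <= eps / 4.
    have sn0 : sin ((w * r - 2 * pi / L%:R * v%:R) / 2) != 0.
      by rewrite -sqrf_eq0 gt_eqF// (lt_le_trans s00).
    apply: le_trans (fejer_le (gsize_gt0 K) sn0) _.
    apply: (@le_trans _ _ (2 / (L%:R * s0))).
      have m1 : 0 < L%:R * s0 by exact: mulr_gt0.
      have m2 := mulr_gt0 L0 (lt_le_trans s00 sE).
      by rewrite ler_pM2l// lef_pV2 ?posrE// ler_pM2l.
    rewrite ler_pdivrMr ?mulr_gt0//.
    move: Ls; rewrite ler_pdivrMr ?mulr_gt0// => Ls.
    nra.
  have d2 : `|sample e K v - e r| <= 2.
    by apply: le_trans (ler_normB _ _) _; rewrite -[leRHS](_ : 1 + 1 = 2)//; apply: lerD; exact: e1.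
  apply: (@le_trans _ _ (2 * (eps / 4))); first by apply: ler_pM.
  apply: ler_wpDl; first by rewrite mulr_ge0// ltW.
  by rewrite le_eqVlt; apply/orP; left; apply/eqP; field.
apply: (@le_trans _ _ (L%:R^-1 * \sum_(v < L)
   (eps / 2 * fejer L (w * r - 2 * pi / L%:R * v%:R) + eps / 2))).
  rewrite ler_wpM2l ?invr_ge0//; apply: le_trans (ler_norm_sum _ _ _) _.
  by apply: ler_sum => v _; exact: term.
rewrite big_split/= -mulr_sumr mulrDr mulrCA fejer_mean ?gsize_gt0//.
rewrite sumr_const card_ord -[(eps / 2) *+ L]mulr_natl mulKf ?gt_eqF// mulr1.
by rewrite -splitr.
Unshelve. all: by end_near. Qed.

(** This separates the sampled function from the point [r]: after integration, the grid coefficients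
    of [e] meet the Fourier coefficients of the distribution frequency by frequency. *)
Lemma fejer_approxE e K r : fejer_approx e K r =
  (gsize K)%:R^-1 * \sum_(j < gsize K) \sum_(k < gsize K)
   (cos ((natdist j k)%:R * w * r) * grid_cos (gsize K) (sample e K) (natdist j k) +
    sin ((natdist j k)%:R * w * r) * grid_sin (gsize K) (sample e K) (natdist j k)).
Proof.
rewrite /fejer_approx; congr (_ * _); rewrite /fejer.
under eq_bigr do rewrite mulrCA mulr_sumr mulr_sumr.
rewrite exchange_big/=; apply: eq_bigr => j _.
under eq_bigr do rewrite mulr_sumr mulr_sumr.
rewrite exchange_big/=; apply: eq_bigr => k _.
rewrite /grid_cos /grid_sin !mulr_sumr -big_split; apply: eq_bigr => v _.
set n := natdist j k; set y := 2 * pi / (gsize K)%:R * _.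
rewrite (_ : n%:R * (w * r - y) = n%:R * w * r - n%:R * y) ?cosB; last by ring.
by rewrite /=; ring.
Qed.

End fejer_approx.

(** * Increments of integrals of functions with small low frequencies *)

Section oscillation.
Context {dT} {T : measurableType dT} {R : realType}.
Variables (mu : {measure set T -> \bar R}) (E : set T) (X : T -> R) (P : nat) (C : R).
Hypotheses (mE : measurable E) (muE : (mu E < +oo)%E) (mX : measurable_fun setT X)
  (P0 : (0 < P)%N).
Let w : R := 2 * pi / P%:R.
Let a (n : nat) : R := \int[mu]_(x in E) cos (n%:R * w * X x).
Let b (n : nat) : R := \int[mu]_(x in E) sin (n%:R * w * X x).
Hypothesis hC : forall N, \sum_(n < N) n.+1%:R ^+ 2 * (a n.+1 ^+ 2 + b n.+1 ^+ 2) <= C.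

Let pf := Rintegral_positive_functional mE muE.

Let w0 : 0 <= w. Proof. by rewrite divr_ge0 ?mulr_ge0 ?pi_ge0. Qed.

Let nw0 (n : nat) : 0 <= n%:R * w. Proof. by apply: mulr_ge0. Qed.

Let bm_comp (f : R -> R) (g : T -> R) : continuous f -> (forall x, `|f x| <= 1) ->
  measurable_fun setT g -> bounded_measurable E (fun x => f (g x)).
Proof.
move=> cf f1 mg; split; last by exists 1.
by apply: measurable_funTS; apply: measurableT_comp => //; exact: continuous_measurable_fun.
Qed.

Let mlin (c t : R) : measurable_fun setT (fun x => c * (X x + t)).
Proof. by apply: measurable_funM => //; exact: measurable_funD. Qed.

Let mlin0 (c : R) : measurable_fun setT (fun x => c * X x).
Proof. exact: measurable_funM. Qed.

Let bcos (c t : R) : bounded_measurable E (fun x => cos (c * (X x + t))).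
Proof. by apply: (@bm_comp cos); [exact: continuous_cos|exact: cos_max|]. Qed.

Let bsin (c t : R) : bounded_measurable E (fun x => sin (c * (X x + t))).
Proof. by apply: (@bm_comp sin); [exact: continuous_sin|exact: sin_max|]. Qed.

Let bcos0 (c : R) : bounded_measurable E (fun x => cos (c * X x)).
Proof. by apply: (@bm_comp cos); [exact: continuous_cos|exact: cos_max|]. Qed.

Let bsin0 (c : R) : bounded_measurable E (fun x => sin (c * X x)).
Proof. by apply: (@bm_comp sin); [exact: continuous_sin|exact: sin_max|]. Qed.

Let int_cos n t : \int[mu]_(x in E) cos (n%:R * w * (X x + t)) =
  cos (n%:R * w * t) * a n - sin (n%:R * w * t) * b n.
Proof.
rewrite (_ : (fun x => _) = fun x => cos (n%:R * w * t) * cos (n%:R * w * X x) -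
    sin (n%:R * w * t) * sin (n%:R * w * X x)); last first.
  by apply/funext => x; rewrite mulrDr cosD; ring.
by rewrite (pfB pf) ?(pfZ pf)//; exact: (pf_scale pf).
Qed.

Let int_sin n t : \int[mu]_(x in E) sin (n%:R * w * (X x + t)) =
  sin (n%:R * w * t) * a n + cos (n%:R * w * t) * b n.
Proof.
rewrite (_ : (fun x => _) = fun x => sin (n%:R * w * t) * cos (n%:R * w * X x) +
    cos (n%:R * w * t) * sin (n%:R * w * X x)); last first.
  by apply/funext => x; rewrite mulrDr sinD; ring.
by rewrite (pfD pf) ?(pfZ pf)//; exact: (pf_scale pf).
Qed.

Let phase_le n (t tau : R) : 0 <= tau ->
  `|n%:R * w * (t + tau) - n%:R * w * t| = n%:R * w * tau.
Proof.
by move=> tau0; rewrite -mulrBr addrAC subrr add0r ger0_norm//; apply: mulr_ge0.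
Qed.

Let int_cos_shift n (t tau : R) : 0 <= tau ->
  `|\int[mu]_(x in E) cos (n%:R * w * (X x + (t + tau))) -
    \int[mu]_(x in E) cos (n%:R * w * (X x + t))| <=
  n%:R * w * tau * (`|a n| + `|b n|).
Proof.
move=> tau0; rewrite !int_cos; set p := n%:R * w * (t + tau); set q := n%:R * w * t.
rewrite [X in `|X|](_ : _ = (cos p - cos q) * a n - (sin p - sin q) * b n); last by ring.
apply: le_trans (ler_normB _ _) _; rewrite !normrM mulrDr -(phase_le _ t tau0).
by apply: lerD; rewrite ler_wpM2r//; [exact: cos_sub_le|exact: sin_sub_le].
Qed.

Let int_sin_shift n (t tau : R) : 0 <= tau ->
  `|\int[mu]_(x in E) sin (n%:R * w * (X x + (t + tau))) -
    \int[mu]_(x in E) sin (n%:R * w * (X x + t))| <=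
  n%:R * w * tau * (`|a n| + `|b n|).
Proof.
move=> tau0; rewrite !int_sin; set p := n%:R * w * (t + tau); set q := n%:R * w * t.
rewrite [X in `|X|](_ : _ = (sin p - sin q) * a n + (cos p - cos q) * b n); last by ring.
apply: le_trans (ler_normD _ _) _; rewrite !normrM mulrDr -(phase_le _ t tau0).
by apply: lerD; rewrite ler_wpM2r//; [exact: sin_sub_le|exact: cos_sub_le].
Qed.

Let hC' N : \sum_(n < N) n%:R ^+ 2 * (a n ^+ 2 + b n ^+ 2) <= C.
Proof.
case: N => [|N].
  by have := hC 0%N; rewrite !big_ord0.
by rewrite big_ord_recl mulr0n expr0n mul0r add0r; exact: hC.
Qed.

Let int_approx e K t : \int[mu]_(x in E) fejer_approx P e K (X x + t) =
  (gsize P K)%:R^-1 * \sum_(j < gsize P K) \sum_(k < gsize P K)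
   (grid_cos (gsize P K) (sample e K) (natdist j k) *
     \int[mu]_(x in E) cos ((natdist j k)%:R * w * (X x + t)) +
    grid_sin (gsize P K) (sample e K) (natdist j k) *
     \int[mu]_(x in E) sin ((natdist j k)%:R * w * (X x + t))).
Proof.
pose c n := grid_cos (gsize P K) (sample e K) n.
pose s n := grid_sin (gsize P K) (sample e K) n.
rewrite (_ : (fun x => _) = fun x => (gsize P K)%:R^-1 *
    \sum_(j < gsize P K) \sum_(k < gsize P K)
    (c (natdist j k) * cos ((natdist j k)%:R * w * (X x + t)) +
     s (natdist j k) * sin ((natdist j k)%:R * w * (X x + t)))); last first.
  apply/funext => x; rewrite fejer_approxE//; congr (_ * _).
  apply: eq_bigr => j _; apply: eq_bigr => k _.
  by congr (_ + _); rewrite mulrC.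
have b1 j k : bounded_measurable E (fun x =>
    (c (natdist j k) * cos ((natdist j k)%:R * w * (X x + t)) +
     s (natdist j k) * sin ((natdist j k)%:R * w * (X x + t)))).
  by apply: (pf_add pf); exact: (pf_scale pf).
have b2 (j : 'I_(gsize P K)) : bounded_measurable E (fun x => \sum_(k < gsize P K)
    (c (natdist j k) * cos ((natdist j k)%:R * w * (X x + t)) +
     s (natdist j k) * sin ((natdist j k)%:R * w * (X x + t)))).
  by apply: (pf_sum pf) => k; exact: b1.
rewrite (pfZ pf); last by apply: (pf_sum pf) => j; exact: b2.
congr (_ * _); rewrite (pfsum pf)//; apply: eq_bigr => j _.
rewrite (pfsum pf); last by move=> k; exact: b1.
apply: eq_bigr => k _; rewrite (pfD pf) ?(pfZ pf)//; exact: (pf_scale pf).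
Qed.

(* [H^1] duality: the coefficients of the increment of [e] are bounded by
   [n w tau] times those of [e], and the factor [n] is absorbed by [hC]. *)
Lemma oscillation_le eps : 0 < eps ->
  exists (N0 : nat) (delta : R), 0 < delta /\ forall (e : R -> R) (t tau : R) (N : set T),
    (forall x, `|e x| <= 1) -> measurable_fun setT e -> 0 <= tau ->
    (forall x, E x -> 0 < X x + t /\ X x + (t + tau) < P%:R) ->
    mu.-negligible N ->
    (forall x, E x -> ~ N x ->
      {for X x + t, continuous e} /\ {for X x + (t + tau), continuous e}) ->
    (\forall K \near \oo, forall n, (n < N0)%N ->
      `|grid_cos (gsize P K) (sample e K) n| + `|grid_sin (gsize P K) (sample e K) n|
        <= delta) ->
    `|\int[mu]_(x in E) e (X x + (t + tau)) - \int[mu]_(x in E) e (X x + t)| <= eps * tau.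
Proof.
move=> eps0.
(* Per unit of [tau], [x n] bounds the change of the [n]-th cosine and sine integrals under the
   shift; [hC] makes it square-summable. *)
pose x n := n%:R * w * (`|a n| + `|b n|).
have x0 n : 0 <= x n by apply: mulr_ge0 => //; exact: addr_ge0.
have sq2 (u v : R) : (`|u| + `|v|) ^+ 2 <= 2 * (u ^+ 2 + v ^+ 2).
  rewrite -(real_normK (num_real u)) -(real_normK (num_real v)) -subr_ge0.
  by rewrite [leRHS](_ : _ = (`|u| - `|v|) ^+ 2) ?sqr_ge0//; ring.
have xC N : \sum_(n < N) x n ^+ 2 <= 2 * w ^+ 2 * C.
  apply: (@le_trans _ _ (\sum_(n < N) 2 * w ^+ 2 * (n%:R ^+ 2 * (a n ^+ 2 + b n ^+ 2)))).
    apply: ler_sum => n _; rewrite /x.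
    rewrite [leLHS](_ : _ = n%:R ^+ 2 * w ^+ 2 * (`|a n| + `|b n|) ^+ 2); last by ring.
    rewrite [leRHS](_ : _ = n%:R ^+ 2 * w ^+ 2 * (2 * (a n ^+ 2 + b n ^+ 2))); last by ring.
    by apply: ler_wpM2l => //; apply: mulr_ge0; exact: sqr_ge0.
  rewrite -mulr_sumr; apply: ler_wpM2l => //.
  by apply: mulr_ge0 => //; exact: sqr_ge0.
(* Half of [eps], to absorb the factor 2 of [sum_natdist_le]. *)
have [N0 [delta [delta0 hdelta]]] := sum_mul_le_tail x0 xC (divr_gt0 eps0 (ltr0n R 2)).
exists N0, delta; split => // e t tau N e1 me tau0 XP negN ce small.
have appr (s : R) : (forall z, E z -> 0 < X z + s < P%:R) ->
    (forall z, E z -> ~ N z -> {for X z + s, continuous e}) ->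
    \int[mu]_(z in E) fejer_approx P e K (X z + s) @[K --> \oo] -->
    \int[mu]_(z in E) e (X z + s).
  move=> Xs cs.
  apply: (@bounded_convergence _ _ _ mu E mE muE
    (fun K z => fejer_approx P e K (X z + s)) _ 1 N) => //.
  - move=> K; under eq_fun do rewrite fejer_approxE//.
    have m1 c : measurable_fun E (fun z => cos (c * (X z + s))) by have [] := bcos c s.
    have m2 c : measurable_fun E (fun z => sin (c * (X z + s))) by have [] := bsin c s.
    apply: measurable_funM => //; apply: measurable_sum => j; apply: measurable_sum => k.
    by apply: measurable_funD; apply: measurable_funM => //.
  - apply: measurable_funTS; apply: (measurableT_comp me).
    exact: measurable_funD.
  - by move=> K z _; exact: fejer_approx_norm_le.
  - by move=> z Ez Nz; apply: fejer_approx_cvg => //; [exact: Xs|exact: cs].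
have XP1 z : E z -> 0 < X z + t < P%:R.
  move=> /XP[-> /= h]; apply: le_lt_trans h; rewrite lerD2l; lra.
have XP2 z : E z -> 0 < X z + (t + tau) < P%:R.
  move=> /XP[h -> /=]; rewrite andbT; apply: lt_le_trans h _; rewrite lerD2l; lra.
have lim : `|\int[mu]_(z in E) fejer_approx P e K (X z + (t + tau)) -
    \int[mu]_(z in E) fejer_approx P e K (X z + t)| @[K --> \oo] -->
    `|\int[mu]_(x in E) e (X x + (t + tau)) - \int[mu]_(x in E) e (X x + t)|.
  apply: cvg_norm; apply: cvgB.
    by apply: appr => [z /XP2//|z Ez Nz]; have [] := ce z Ez Nz.
  by apply: appr => [z /XP1//|z Ez Nz]; have [] := ce z Ez Nz.
(* The estimate below is uniform in large [K], so it passes to the limit of the Fejer means. *)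
apply: (cvgr_to_le lim); near=> K.
have ysmall : forall n, (n < N0)%N -> `|grid_cos (gsize P K) (sample e K) n| +
    `|grid_sin (gsize P K) (sample e K) n| <= delta by near: K.
have L0 : 0 < (gsize P K)%:R :> R by rewrite ltr0n gsize_gt0.
set L := gsize P K in L0 *.
pose y n := `|grid_cos L (sample e K) n| + `|grid_sin L (sample e K) n|.
have y0 n : 0 <= y n by rewrite addr_ge0.
have y2 : \sum_(n < L) y n ^+ 2 <= 2.
  rewrite -[leRHS]mulr1; apply: le_trans (ler_wpM2l _ (grid_bessel (gsize_gt0 P0 K)
     (f := sample e K) (fun v => e1 _))) => //.
  by rewrite mulr_sumr; apply: ler_sum => n _; exact: sq2.
have := hdelta L y y0 y2 ysmall => hsum.
rewrite !int_approx -mulrBr -sumrB normrM ger0_norm ?invr_ge0//.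
apply: (@le_trans _ _ (L%:R^-1 * \sum_(j < L) \sum_(k < L)
  (fun n => tau * (x n * y n)) (natdist j k))).
  rewrite ler_wpM2l ?invr_ge0//; apply: le_trans (ler_norm_sum _ _ _) _.
  apply: ler_sum => j _; rewrite -sumrB; apply: le_trans (ler_norm_sum _ _ _) _.
  apply: ler_sum => k _; set n := natdist j k.
  rewrite opprD addrACA -!mulrBr; apply: le_trans (ler_normD _ _) _.
  rewrite (normrM (grid_cos L _ n)) (normrM (grid_sin L _ n)).
  rewrite [leRHS](_ : _ = `|grid_cos L (sample e K) n| * (n%:R * w * tau * (`|a n| + `|b n|)) +
      `|grid_sin L (sample e K) n| * (n%:R * w * tau * (`|a n| + `|b n|))); last first.
    by rewrite /x /y; ring.
  by apply: lerD; rewrite ler_wpM2l//; [exact: int_cos_shift|exact: int_sin_shift].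
apply: (@le_trans _ _ (L%:R^-1 * (2 * L%:R * \sum_(n < L) tau * (x n * y n)))).
  rewrite ler_wpM2l ?invr_ge0//.
  apply: (@sum_natdist_le _ _ (fun n => tau * (x n * y n))) => n.
  by apply: mulr_ge0 => //; apply: mulr_ge0.
rewrite -mulr_sumr [leLHS](_ : _ = (2 * tau) * \sum_(n < L) x n * y n); last first.
  by field; rewrite gt_eqF.
apply: (@le_trans _ _ (2 * tau * (eps / 2))); first by rewrite ler_wpM2l// mulr_ge0.
by rewrite le_eqVlt; apply/orP; left; apply/eqP; field.
Unshelve. all: by end_near. Qed.

End oscillation.

(** * The test sets *)

Section phi.
Context {R : realType}.

(** A sigmoid with values between 1/4 and 3/4 and derivative [1 / (4 (1 + |r|)^2)]; its algebraic
    form makes increments explicit. *)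
Definition phi (r : R) : R := 1 / 2 + r / (4 * (1 + `|r|)).

Let d0 (r : R) : 0 < 1 + `|r|. Proof. by rewrite ltr_pwDl. Qed.

Lemma phi_itv r : 0 <= phi r <= 1.
Proof.
have h : `|r / (4 * (1 + `|r|))| <= 1 / 2.
  rewrite normrM normfV (gtr0_norm (_ : 0 < 4 * (1 + `|r|))) ?mulr_gt0//.
  rewrite ler_pdivrMr ?mulr_gt0//; have := normr_ge0 r; lra.
by move: h; rewrite /phi ler_norml => /andP[? ?]; apply/andP; split; lra.
Qed.

Lemma phi_sub r r' : phi r' - phi r =
  (r' - r + (r' * `|r| - r * `|r'|)) / (4 * (1 + `|r|) * (1 + `|r'|)).
Proof. by rewrite /phi; field; rewrite !gt_eqF. Qed.

(** The rate is the least derivative of [phi] on [[- B, B]]. In [phi_sub] the mixed term vanishes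
    for equal signs and is [- 2 r r' >= 0] otherwise. *)
Lemma phi_increase B r r' : `|r| <= B -> `|r'| <= B -> r <= r' ->
  (r' - r) / (4 * (1 + B) ^+ 2) <= phi r' - phi r.
Proof.
move=> rB r'B rr'; rewrite phi_sub.
have B0 : 0 <= B by apply: le_trans rB.
apply: ler_pM; [by rewrite subr_ge0| |rewrite lerDl|].
- by rewrite invr_ge0 mulr_ge0// sqr_ge0.
- have [r0|/ltW r0] := leP 0 r; have [r'0|/ltW r'0] := leP 0 r'.
  + by rewrite !ger0_norm// mulrC subrr.
  + have -> : r' = 0 by apply/eqP; rewrite eq_le r'0 (le_trans r0).
    by rewrite normr0 mul0r mulr0 subrr.
  + have := mulr_le0_ge0 r0 r'0; rewrite (ler0_norm r0) (ger0_norm r'0); lra.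
  + by rewrite !ler0_norm// !mulrN mulrC subrr.
- rewrite lef_pV2 ?posrE ?mulr_gt0 ?exprn_gt0 ?ltr_pwDl//.
  by rewrite -mulrA ler_pM2l// expr2 ler_pM ?lerD2l// ltW.
Qed.

Lemma phi_lipschitz r r' : `|phi r - phi r'| <= `|r - r'|.
Proof.
wlog rr' : r r' / r' <= r.
  move=> h; have [/h//|/ltW/h] := leP r' r.
  by rewrite distrC [X in _ <= X -> _]distrC.
have D0 : 0 < 4 * (1 + `|r'|) * (1 + `|r|) by rewrite !mulr_gt0.
rewrite phi_sub normrM normfV (gtr0_norm D0) ler_pdivrMr//.
rewrite (ger0_norm (_ : 0 <= r - r')) ?subr_ge0//.
apply: (@le_trans _ _ ((r - r') * (1 + `|r| + `|r'|))); last first.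
  rewrite ler_wpM2l ?subr_ge0//; have := normr_ge0 r; have := normr_ge0 r'.
  move: `|r| `|r'| => x y y0 x0; have := mulr_ge0 x0 y0; nra.
have d1 : 0 <= r - r' by rewrite subr_ge0.
have [r0|/ltW r0] := leP 0 r; have [r'0|/ltW r'0] := leP 0 r'.
- rewrite (ger0_norm r0) (ger0_norm r'0) ler_norml.
  have := mulr_ge0 d1 r0; have := mulr_ge0 d1 r'0 => ? ?.
  by apply/andP; split; lra.
- rewrite (ger0_norm r0) (ler0_norm r'0) ler_norml.
  have := sqr_ge0 (r + r'); have := mulr_ge0 r0 (_ : 0 <= - r'); rewrite oppr_ge0 => /(_ r'0).
  by move=> ? ?; apply/andP; split; nra.
- have -> : r = r' by apply/eqP; rewrite eq_le rr' (le_trans r0).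
  by rewrite !subrr addr0 normr0 mul0r.
- rewrite (ler0_norm r0) (ler0_norm r'0) ler_norml.
  have h1 : 0 <= (r - r') * (- r) by rewrite mulr_ge0// oppr_ge0.
  have h2 : 0 <= (r - r') * (- r') by rewrite mulr_ge0// oppr_ge0.
  by apply/andP; split; lra.
Qed.

Lemma phi_continuous : continuous phi.
Proof.
move=> r; apply/cvgrPdist_lt => eps eps0; near=> s.
apply: le_lt_trans (phi_lipschitz _ _) _.
by near: s; exact: cvgr_dist_lt.
Unshelve. all: by end_near. Qed.

(** The count is the ceiling of [y]. *)
Lemma count_lt (h : nat) (y : R) : 0 <= y <= h%:R ->
  `|\sum_(i < h) (i%:R < y)%R%:R - y| <= 1.
Proof.
elim: h => [|h IH] /andP[y0 yh].
  have -> : y = 0 by apply/eqP; rewrite eq_le yh.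
  by rewrite big_ord0 subrr normr0.
rewrite big_ord_recr/=; have [yh'|hy] := leP y h%:R.
  by rewrite addr0; apply: IH; rewrite y0.
rewrite (eq_bigr (fun=> 1)) => [|i _]; last first.
  by rewrite (lt_trans _ hy) ?ltr_nat.
rewrite sumr_const card_ord; move: yh hy; rewrite -natr1 => yh hy.
by rewrite ler_norml; apply/andP; split; rewrite /=; lra.
Qed.

(** Freeze [f] and [phi] at the left end of a cell with [h] sample points. The three terms are the
    rounding of [h * phi x0] to an integer, the drift of [phi] over a cell of length [1 / N], and
    the variation of [f]. *)
Lemma cell_sum_le (h : nat) (N x0 be : R) (f : nat -> R) : (0 < h)%N -> 0 < N ->
  (forall i, `|f i| <= 1) -> (forall i, (i < h)%N -> `|f i - f 0%N| <= be) ->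
  `|\sum_(i < h) ((i%:R < h%:R * phi x0)%R%:R - phi (x0 + i%:R / (h%:R * N))) * f i|
  <= 1 + h%:R / N + h%:R * be.
Proof.
move=> h0 N0 f1 fbe.
have hR : 0 < h%:R :> R by rewrite ltr0n.
pose E (i : nat) : R := (i%:R < h%:R * phi x0)%R%:R - phi (x0 + i%:R / (h%:R * N)).
have E1 i : `|E i| <= 1.
  have /andP[p0 p1] := phi_itv (x0 + i%:R / (h%:R * N)).
  by rewrite ler_norml /E; case: (_ < _); apply/andP; split; rewrite /=; lra.
rewrite [X in `|X|](_ : _ = f 0%N * \sum_(i < h) E i +
    \sum_(i < h) E i * (f i - f 0%N)); last first.
  by rewrite mulr_sumr -big_split; apply: eq_bigr => i _ /=; rewrite -/(E i); ring.
apply: le_trans (ler_normD _ _) _; apply: lerD; last first.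
  apply: le_trans (ler_norm_sum _ _ _) _.
  apply: (@le_trans _ _ (\sum_(i < h) be)); last by rewrite sumr_const card_ord mulr_natl.
  apply: ler_sum => i _; rewrite normrM -[leRHS]mul1r.
  by apply: ler_pM => //; exact: fbe.
rewrite normrM; apply: (@le_trans _ _ `|\sum_(i < h) E i|).
  by rewrite -[leRHS]mul1r ler_wpM2r.
rewrite [X in `|X|](_ : _ = (\sum_(i < h) (i%:R < h%:R * phi x0)%R%:R - h%:R * phi x0) +
   \sum_(i < h) (phi x0 - phi (x0 + i%:R / (h%:R * N)))); last first.
  rewrite !sumrB sumr_const card_ord -[phi x0 *+ h]mulr_natl; ring.
apply: le_trans (ler_normD _ _) _; apply: lerD.
  apply: count_lt; have /andP[p0 p1] := phi_itv x0.
  by rewrite mulr_ge0//= -[leRHS]mulr1 ler_pM2l.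
apply: le_trans (ler_norm_sum _ _ _) _.
apply: (@le_trans _ _ (\sum_(i < h) N^-1)); last by rewrite sumr_const card_ord mulr_natl.
apply: ler_sum => i _; apply: le_trans (phi_lipschitz _ _) _.
rewrite opprD addrA subrr sub0r normrN ger0_norm; last first.
  by rewrite divr_ge0// mulr_ge0// ltW.
rewrite invfM mulrA -[leRHS]mul1r ler_wpM2r ?invr_ge0 ?(ltW N0)//.
by rewrite ler_pdivrMr// mul1r ler_nat ltnW.
Qed.

End phi.

(** * Comb sets and their sampled errors *)

Section comb.
Context {R : realType} (kap : int -> nat).

(** A power of two, so that every fine enough dyadic grid subdivides the cells exactly. *)
Definition mesh (m : int) : R := (2 ^ kap m)%:R.

(* On [m, m+1[ the cells have length [1 / mesh m], and [comb] is the initial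
   fraction [phi] (evaluated at the left endpoint) of each cell. *)
Definition comb : set R := [set r |
  let N := mesh (Num.floor r) in let c := Num.floor (N * r) in
  N * r - c%:~R < phi (c%:~R / N)].

Lemma mesh_gt0 m : 0 < mesh m.
Proof. by rewrite ltr0n expn_gt0. Qed.

Lemma combE r (m c : int) : Num.floor r = m -> Num.floor (mesh m * r) = c ->
  comb r = (mesh m * r - c%:~R < phi (c%:~R / mesh m)).
Proof. by rewrite /comb /= => -> ->. Qed.

Lemma measurable_comb : measurable comb.
Proof.
pose piece (mc : int * int) : set R :=
  `[mc.1%:~R, (mc.1 + 1)%:~R[ `&` `[mc.2%:~R / mesh mc.1, (mc.2 + 1)%:~R / mesh mc.1[ `&`
  `]-oo, (mc.2%:~R + phi (mc.2%:~R / mesh mc.1)) / mesh mc.1[.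
have -> : comb = \bigcup_mc piece mc.
  apply/seteqP; split => r.
    move=> Sr; exists (Num.floor r, Num.floor (mesh (Num.floor r) * r)) => //.
    have N0 := mesh_gt0 (Num.floor r).
    rewrite /piece /= !in_itv/= floor_itv; split; [split => //|].
      by rewrite ler_pdivrMr// ltr_pdivlMr// ![r * _]mulrC floor_itv.
    by rewrite ltr_pdivlMr// mulrC -ltrBlDl.
  move=> [[m c] _ []] [] /=; rewrite !in_itv/=.
  have N0 := mesh_gt0 m.
  move=> /floor_def mr; rewrite ler_pdivrMr// ltr_pdivlMr// ltr_pdivlMr// ![r * _]mulrC.
  by move=> /floor_def cr; rewrite (combE mr cr) ltrBlDl.
apply: countable_bigcupT_measurable; first exact: countableP.
by move=> mc; do 2 (apply: measurableI; last exact: measurable_itv); exact: measurable_itv.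
Qed.

(** Candidates for discontinuities: left ends of cells ([false]) and right ends of their filled
    parts ([true]). The index type is countable, so the points of [E] sent to a jump will form a
    null set. *)
Definition jump (z : int * int * bool) : R :=
  (z.1.2%:~R + (if z.2 then phi (z.1.2%:~R / mesh z.1.1) else 0)) / mesh z.1.1.

Definition comb_error (r : R) : R := \1_comb r - phi r.

Lemma comb_error_continuous r : (forall z, r <> jump z) -> {for r, continuous comb_error}.
Proof.
move=> rJ; apply: cvgB; last exact: phi_continuous.
pose m := Num.floor r; pose N := mesh m; pose c := Num.floor (N * r).
have N0 : 0 < N by exact: mesh_gt0.
have /andP[mr rm] := floor_itv r.
have /andP[cr rc] := floor_itv (N * r).
have mr' : m%:~R < r.
  rewrite lt_neqAle mr andbT; apply/eqP => mE.
  (* An integer, where the cell length may change, is itself the left end of a cell. *)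
  apply: (rJ (m, m * (2 ^ kap m)%:Z, false)); rewrite /jump /= addr0 rmorphM/= -pmulrn.
  by rewrite mulfK ?gt_eqF// mesh_gt0.
have cr' : c%:~R < N * r.
  rewrite lt_neqAle cr andbT; apply/eqP => cE; apply: (rJ (m, c, false)).
  by rewrite /jump /= addr0 cE mulrC mulKf// gt_eqF.
have cphi : N * r - c%:~R <> phi (c%:~R / N).
  move=> cE; apply: (rJ (m, c, true)).
  by rewrite /jump /= -cE addrCA subrr addr0 mulrC mulKf// gt_eqF.
have cN : N * s @[s --> r] --> N * r by apply: cvgMr; exact: cvg_id.
have near_eq : \forall s \near r, \1_comb s = \1_comb r :> R.
  have sgn : \forall s \near r,
      (N * s - c%:~R < phi (c%:~R / N)) = (N * r - c%:~R < phi (c%:~R / N)).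
    have cNc : N * s - c%:~R @[s --> r] --> N * r - c%:~R.
      by apply: cvgB => //; exact: cvg_cst.
    have [h|h] := ltP (N * r - c%:~R) (phi (c%:~R / N)).
      by near=> s; near: s; exact: (cvgr_lt _ cNc).
    have {}h : phi (c%:~R / N) < N * r - c%:~R.
      by rewrite lt_neqAle h andbT; apply/eqP => /esym.
    near=> s; apply/negbTE; rewrite -leNgt ltW//.
    by near: s; exact: (cvgr_gt _ cNc).
  near=> s.
  have fs : Num.floor s = m.
    apply: floor_def; apply/andP; split.
      by apply: ltW; near: s; exact: (cvgr_gt _ (@cvg_id _ (nbhs r))).
    by near: s; exact: (cvgr_lt _ (@cvg_id _ (nbhs r))).
  have fNs : Num.floor (N * s) = c.
    apply: floor_def; apply/andP; split.
      by apply: ltW; near: s; exact: (cvgr_gt _ cN).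
    by near: s; exact: (cvgr_lt _ cN).
  have E : comb s = comb r.
    rewrite (combE fs fNs) (combE (erefl : Num.floor r = m) (erefl : Num.floor (N * r) = c)).
    by congr is_true; near: s.
  by rewrite !indicE; congr (_%:R); congr nat_of_bool; apply/idP/idP; rewrite !inE E.
apply/cvgrPdist_lt => eps eps0; near=> s.
have -> : \1_comb s = \1_comb r :> R by near: s.
by rewrite subrr normr0.
Unshelve. all: by end_near. Qed.

Lemma comb_error_norm_le r : `|comb_error r| <= 1.
Proof.
have /andP[p0 p1] := phi_itv r.
by rewrite ler_norml /comb_error indicE; case: (_ \in _); apply/andP; split; rewrite /=; lra.
Qed.

Lemma measurable_comb_error : measurable_fun [set: R] comb_error.
Proof.
apply: measurable_funB; first by apply: measurable_indic; exact: measurable_comb.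
by apply: continuous_measurable_fun; exact: phi_continuous.
Qed.

(** The cell starting at [x0] contains exactly [h] grid points, the [i]-th at relative position
    [i / h], so membership in the comb reads [i < h * phi x0]. *)
Lemma comb_error_sample (m0 : int) (K p c i : nat) :
  let m := m0 + p%:Z in (kap m <= K)%N -> (c < 2 ^ kap m)%N ->
  let h := (2 ^ (K - kap m))%N in let x0 := m%:~R + c%:R / mesh m in (i < h)%N ->
  comb_error (m0%:~R + (p * 2 ^ K + (c * h + i))%:R / (2 ^ K)%:R) =
  (i%:R < h%:R * phi x0)%R%:R - phi (x0 + i%:R / (h%:R * mesh m)).
Proof.
move=> m kK cN h x0 ih.
have N0 := mesh_gt0 m.
have h0 : 0 < h%:R :> R by rewrite ltr0n expn_gt0.
have hN : (2 ^ K)%:R = h%:R * mesh m :> R by rewrite -natrM -expnD subnK.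
have rE : m0%:~R + (p * 2 ^ K + (c * h + i))%:R / (2 ^ K)%:R = x0 + i%:R / (h%:R * mesh m).
  rewrite hN !natrD !natrM hN /x0 /m rmorphD/= -pmulrn; field.
  by rewrite !gt_eqF.
rewrite rE /comb_error; congr (_ - _).
clear rE; clearbody m.
set r := x0 + _.
pose C : int := m * (2 ^ kap m)%:Z + c%:Z.
have CE : C%:~R = mesh m * x0.
  rewrite /C intrD intrM -!pmulrn -/(mesh m) /x0; field.
  by rewrite gt_eqF.
have NrE : mesh m * r = C%:~R + i%:R / h%:R.
  by rewrite CE /r; field; rewrite !gt_eqF.
have ih1 : i%:R / h%:R < 1 :> R by rewrite ltr_pdivrMr// mul1r ltr_nat.
have ih0 : 0 <= i%:R / h%:R :> R by rewrite divr_ge0.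
have fNr : Num.floor (mesh m * r) = C.
  by apply: floor_def; rewrite NrE intrD; apply/andP; split; rewrite ?lerDl// ltrD2l.
have fr : Num.floor r = m.
  apply: floor_def; rewrite intrD -(ler_pM2l N0) -(ltr_pM2l N0) NrE /C intrD intrM.
  rewrite -!pmulrn -/(mesh m).
  have c1 : c%:R + 1 <= mesh m by rewrite natr1 ler_nat.
  have c0 : 0 <= c%:R :> R by [].
  apply/andP; split; lra.
rewrite indicE (_ : (r \in comb) = (i%:R < h%:R * phi x0))//.
rewrite (_ : (r \in comb) = (mesh m * r - C%:~R < phi (C%:~R / mesh m))); last first.
  by apply/idP/idP; rewrite inE (combE fr fNr).
rewrite NrE addrAC subrr add0r CE [mesh m * x0]mulrC mulfK ?gt_eqF//.
by rewrite ltr_pdivrMr// mulrC.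
Qed.

End comb.

Section grid_comb.
Context {R : realType} (kap : int -> nat) (P : nat).
Hypothesis P0 : (0 < P)%N.
Let w : R := 2 * pi / P%:R.

Let w0 : 0 <= w. Proof. by rewrite divr_ge0 ?mulr_ge0 ?pi_ge0. Qed.

(** By [cell_sum_le], a unit interval contributes at most [mesh + h * (1 + n w)], where
    [h * mesh = 2 ^ K]. The second condition asks for many sample points per cell, the third for
    cells short compared with the wavelength; each bounds one summand by [eta * 2 ^ K]. *)
Lemma grid_comb_error_le (m0 : int) (K n : nat) (eta : R) (f : R -> R) :
  (forall x, `|f x| <= 1) -> (forall x y, `|f x - f y| <= `|x - y|) ->
  (forall p, (p < P)%N -> (kap (m0 + p%:Z) <= K)%N /\
    mesh kap (m0 + p%:Z) <= eta * (2 ^ K)%:R /\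
    1 + n%:R * w <= eta * mesh kap (m0 + p%:Z)) ->
  `|(gsize P K)%:R^-1 * \sum_(v < gsize P K)
     sample (fun r => comb_error kap (m0%:~R + r)) K v *
     f (n%:R * (2 * pi / (gsize P K)%:R * v%:R))| <= 2 * eta.
Proof.
move=> f1 fL hp.
have L0 : 0 < (gsize P K)%:R :> R by rewrite ltr0n gsize_gt0.
have K0 : 0 < (2 ^ K)%:R :> R by rewrite ltr0n expn_gt0.
pose G (v : nat) := comb_error kap (m0%:~R + v%:R / (2 ^ K)%:R) *
  f (n%:R * (w * (v%:R / (2 ^ K)%:R))).
rewrite (eq_bigr (fun v : 'I_(gsize P K) => G v)) => [|v _]; last by rewrite grid_angle.
rewrite normrM ger0_norm ?invr_ge0// -ler_pdivlMl ?invr_gt0// invrK.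
have -> : \sum_(v < gsize P K) G v = \sum_(p < P) \sum_(a < 2 ^ K) G (p * 2 ^ K + a)%N.
  by rewrite /gsize sum_mul_ord.
apply: le_trans (ler_norm_sum _ _ _) _.
apply: (@le_trans _ _ (\sum_(p < P) 2 * eta * (2 ^ K)%:R)); last first.
  rewrite sumr_const card_ord -[leLHS]mulr_natl /gsize natrM.
  by rewrite le_eqVlt; apply/orP; left; apply/eqP; ring.
apply: ler_sum => p _; have [kK [NK nN]] := hp p (ltn_ord p).
set m := m0 + p%:Z in kK NK nN *.
pose h := (2 ^ (K - kap m))%N.
have h0 : (0 < h)%N by rewrite expn_gt0.
have hR : 0 < h%:R :> R by rewrite ltr0n.
have hN : (2 ^ K = 2 ^ kap m * h)%N by rewrite -expnD subnKC.
have N0 := @mesh_gt0 R kap m.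
have hNR : (2 ^ K)%:R = h%:R * mesh kap m :> R by rewrite hN natrM mulrC.
have -> : \sum_(a < 2 ^ K) G (p * 2 ^ K + a)%N =
    \sum_(c < 2 ^ kap m) \sum_(i < h) G (p * 2 ^ K + (c * h + i))%N.
  by rewrite -(sum_mul_ord _ _ (fun a => G (p * 2 ^ K + a)%N)) -hN.
apply: le_trans (ler_norm_sum _ _ _) _.
apply: (@le_trans _ _ (\sum_(c < 2 ^ kap m)
  (1 + h%:R / mesh kap m + h%:R * (n%:R * w / mesh kap m)))).
  apply: ler_sum => c _.
  pose x0 : R := m%:~R + c%:R / mesh kap m.
  pose g (i : nat) := f (n%:R * (w * ((p * 2 ^ K + (c * h + i))%:R / (2 ^ K)%:R))).
  rewrite (eq_bigr (fun i : 'I_h => ((i%:R < h%:R * phi x0)%R%:R -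
      phi (x0 + i%:R / (h%:R * mesh kap m))) * g i)) => [|i _]; last first.
    by rewrite /G comb_error_sample.
  apply: cell_sum_le => // [i|i ih]; [exact: f1|apply: le_trans (fL _ _) _].
  rewrite -!mulrBr -mulrBl addn0 !natrD !natrM hNR.
  rewrite [X in `|X|](_ : _ = n%:R * w * (i%:R / (h%:R * mesh kap m))); last first.
    by field; rewrite !gt_eqF.
  have nw0 : 0 <= n%:R * w by rewrite mulr_ge0.
  rewrite ger0_norm; last by apply: mulr_ge0 => //; rewrite divr_ge0// mulr_ge0// ltW.
  rewrite ler_wpM2l// invfM mulrA -[leRHS]mul1r ler_wpM2r ?invr_ge0 ?(ltW N0)//.
  by rewrite ler_pdivrMr// mul1r ler_nat ltnW.
rewrite sumr_const card_ord -[leLHS]mulr_natl -/(mesh kap m).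
rewrite [leLHS](_ : _ = mesh kap m + h%:R * (1 + n%:R * w)); last first.
  by field; rewrite gt_eqF.
rewrite [leRHS](_ : _ = eta * (2 ^ K)%:R + eta * (2 ^ K)%:R); last by ring.
apply: lerD => //.
by rewrite hNR [leRHS]mulrCA ler_pM2l.
Qed.

End grid_comb.

(** * A comb whose overlap is strictly increasing *)

Section reconstruction.
Context {dT} {T : measurableType dT} {R : realType}.
Variables (mu : {measure set T -> \bar R}) (E : set T) (X : T -> R) (P : nat) (A C : R).
Hypotheses (mE : measurable E) (muE : (mu E < +oo)%E) (E0 : (0 < mu E)%E)
  (mX : measurable_fun setT X) (XA : forall x, E x -> `|X x| <= A)
  (AP : 2 * A + 3 <= P%:R)
  (X0 : forall c, mu.-negligible (E `&` [set x | X x = c])).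
Hypothesis hC : forall N, \sum_(n < N) n.+1%:R ^+ 2 *
  ((\int[mu]_(x in E) cos (n.+1%:R * (2 * pi / P%:R) * X x)) ^+ 2 +
   (\int[mu]_(x in E) sin (n.+1%:R * (2 * pi / P%:R) * X x)) ^+ 2) <= C.
Hypothesis P0 : (0 < P)%N.
Let w : R := 2 * pi / P%:R.
Let w0 : 0 <= w. Proof. by rewrite divr_ge0 ?mulr_ge0 ?pi_ge0. Qed.
Let M : R := fine (mu E).
Let M0 : 0 < M. Proof. by rewrite fine_gt0// E0 muE. Qed.

(** Half the rate at which [phi] increases the overlap on the window [[m, m + P]], by [phi_increase]
    with [B = |m| + P]; the error may thus consume half of the gain. *)
Let eps (m : int) : R := M / (8 * (1 + (`|m|%:~R + P%:R)) ^+ 2).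

Let D0 (m : int) : 0 < 1 + (`|m|%:~R + P%:R) :> R.
Proof. by rewrite ltr_pwDl// addr_ge0// ler0z. Qed.

Let eps0 m : 0 < eps m.
Proof. by rewrite divr_gt0// mulr_gt0// exprn_gt0. Qed.

Lemma exists_increasing_overlap : exists S : set R, measurable S /\
  forall t t', t < t' ->
    \int[mu]_(x in E) \1_S (X x + t) < \int[mu]_(x in E) \1_S (X x + t') :> R.
Proof.
have osc m := oscillation_le mE muE mX P0 hC (eps0 m).
have /choice[N0 osc1] := osc.
have /choice[delta osc2] := osc1.
(* [grid_comb_error_le] costs [2 * eta] for the cosine and again for the sine. *)
pose eta (m : int) : R := (delta m : R) / 4.
have eta0 m : 0 < eta m by rewrite divr_gt0//; have [] := osc2 m.
pose k0 m := (Num.truncn ((1 + (N0 m)%:R * w) / eta m)).+1.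
(* The unit interval at [m] lies in the windows starting at [m - q] for [q < P]; the sum dominates
   the exponent that each of them requires. *)
pose kap (m : int) := (\sum_(q < P) k0 (m - q%:Z)%R)%N.
have kap_ge m p : (p < P)%N -> (k0 m <= kap (m + p%:Z)%R)%N.
  by move=> pP; rewrite /kap (bigD1 (Ordinal pP))//= addrK leq_addr.
exists (comb kap); split; first exact: measurable_comb.
pose g t : R := \int[mu]_(x in E) \1_(comb kap) (X x + t).
(* Short steps keep both arguments in a common window; longer ones are chained. *)
suff step t tau : 0 < tau -> tau <= 1 -> g t < g (t + tau).
  have chain n : forall t t', t < t' -> t' - t <= n%:R -> g t < g t'.
    elim: n => [|n IH] t t' tt' h; first by move: h; rewrite subr_le0 leNgt tt'.
    have [h1|h1] := leP (t' - t) 1.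
      by rewrite -[t'](subrK t) addrC; apply: step => //; rewrite subr_gt0.
    apply: (@lt_trans _ _ (g (t + 1))); first exact: step.
    apply: IH; first by rewrite -ltrBrDl.
    by rewrite opprD addrA lerBlDr natr1.
  move=> t t' tt'; apply: (chain (Num.truncn (t' - t)).+1) => //.
  by rewrite ltW// truncnS_gt.
move=> tau0 tau1.
(* Subtracting 1 puts [X + t] strictly to the right of the window's start. The 3 in [2 * A + 3 <= P]
   pays for this margin, the rounding and [tau <= 1]. *)
pose m := Num.floor (t - A) - 1.
have /andP[f1 f2] := floor_itv (t - A).
have mle : m%:~R <= t - A - 1 by rewrite intrB lerD2r.
have mgt : t - A - 2 < m%:~R.
  by move: f2; rewrite /m intrB intrD; lra.
have pf := Rintegral_positive_functional mE muE.
have mXs s : measurable_fun setT (fun x => X x + s) by exact: measurable_funD.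
have bphi s : bounded_measurable E (fun x => phi (X x + s)).
  split.
    apply: measurable_funTS; apply: measurableT_comp => //.
    by apply: continuous_measurable_fun; exact: phi_continuous.
  by exists 1 => x _; have /andP[p0 p1] := phi_itv (X x + s); rewrite ger0_norm.
have bind s : bounded_measurable E (fun x => \1_(comb kap) (X x + s)).
  split.
    apply: measurable_funTS; apply: measurableT_comp => //.
    by apply: measurable_indic; exact: measurable_comb.
  by exists 1 => x _; rewrite indicE; case: (_ \in _); rewrite ?normr0 ?normr1.
pose B : R := `|m|%:~R + P%:R.
have range s x : E x -> t <= s -> s <= t + 1 -> `|X x + s| <= B.
  move=> /XA; rewrite ler_norml => /andP[x1 x2] s1 s2.
  have : `|m%:~R : R| = `|m|%:~R by rewrite intr_norm.
  rewrite /B => <-; have := ler_norm (m%:~R : R); have := ler_norm (- m%:~R : R).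
  rewrite normrN ler_norml => n1 n2; move: mle mgt n1 n2 AP s1 s2 x1 x2.
  move: (m%:~R : R) => y; move: `|y| => z *; apply/andP; split; lra.
have phi_inc : tau * (2 * eps m) <=
    \int[mu]_(x in E) phi (X x + (t + tau)) - \int[mu]_(x in E) phi (X x + t).
  rewrite -(pfB pf)//.
  have -> : tau * (2 * eps m) = \int[mu]_(x in E) (tau / (4 * (1 + B) ^+ 2)).
    by rewrite Rintegral_cst// /eps -/B -/M; field; rewrite gt_eqF// D0.
  apply: le_Rintegral => //.
  - apply: bounded_measurable_integrable => //; exact: (pf_cst pf).
  - apply: bounded_measurable_integrable => //; exact: (pf_sub pf).
  - move=> x Ex.
    have r1 : `|X x + t| <= B by apply: range => //; rewrite lerDl.
    have r2 : `|X x + (t + tau)| <= B.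
      by apply: range => //; [rewrite lerDl ltW|rewrite lerD2l].
    have := phi_increase r1 r2; rewrite addrA lerDl ltW// => /(_ isT).
    by rewrite [X x + t + tau - _]addrAC subrr add0r.
have err s : \int[mu]_(x in E) comb_error kap (X x + s) = g s - \int[mu]_(x in E) phi (X x + s).
  by rewrite /g -(pfB pf).
have [_ /(_ (fun r => comb_error kap (m%:~R + r)) (t - m%:~R) tau)] := osc2 m.
(* The jumps are enumerated through [pickle], and each is hit by [X + t] or [X + (t + tau)] on a
   null set by [X0]. *)
pose F (n : nat) : set T := if unpickle n is Some z then
    (E `&` [set x | X x = jump kap z - t]) `|`
    (E `&` [set x | X x = jump kap z - (t + tau)])
  else set0.
move=> /(_ (\bigcup_n F n)) h.
have {h} : `|\int[mu]_(x in E) comb_error kap (X x + (t + tau)) -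
   \int[mu]_(x in E) comb_error kap (X x + t)| <= eps m * tau.
  have e1 s : \int[mu]_(x in E) comb_error kap (m%:~R + (X x + (t - m%:~R + s))) =
      \int[mu]_(x in E) comb_error kap (X x + (t + s)).
    by apply: eq_Rintegral => x _; congr comb_error; ring.
  have e2 : \int[mu]_(x in E) comb_error kap (m%:~R + (X x + (t - m%:~R))) =
      \int[mu]_(x in E) comb_error kap (X x + t).
    by apply: eq_Rintegral => x _; congr comb_error; ring.
  rewrite -e1 -e2; apply: h.
  - by move=> x; exact: comb_error_norm_le.
  - apply: (measurableT_comp (@measurable_comb_error R kap)).
    exact: measurable_funD.
  - exact: ltW.
  - move=> x /XA; rewrite ler_norml => /andP[x1 x2].
    move: mle mgt AP x1 x2 tau1; move: (m%:~R : R) => y *; split; lra.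
  - apply: negligible_bigcup => n; rewrite /F; case: (unpickle n) => [z|].
      by apply: negligibleU; exact: X0.
    exact: negligible_set0.
  - move=> x Ex NF.
    have cont (s r : R) : m%:~R + s = r -> (forall z, r <> jump kap z) ->
        {for s, continuous (fun r : R => comb_error kap (m%:~R + r))}.
      move=> sr rj; apply: continuous_comp; last first.
        by rewrite sr; exact: comb_error_continuous.
      by apply: cvgD; [exact: cvg_cst|exact: cvg_id].
    split.
      apply: (cont _ (X x + t)); first by ring.
      move=> z hz; apply: NF; apply: (ex_intro2 _ _ (pickle z) I); rewrite /F pickleK; left.
      by split => //=; rewrite -hz addrK.
    apply: (cont _ (X x + (t + tau))); first by ring.
    move=> z hz; apply: NF; apply: (ex_intro2 _ _ (pickle z) I); rewrite /F pickleK; right.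
    by split => //=; rewrite -hz addrK.
  - pose W : R := \sum_(p < P) mesh kap (m + p%:Z) / eta m.
    have Wp (p : 'I_P) : mesh kap (m + p%:Z) / eta m <= W.
      rewrite /W (bigD1 p)//= lerDl sumr_ge0// => q _.
      by rewrite divr_ge0 ?ltW// mesh_gt0.
    pose kk := (\sum_(p < P) kap (m + p%:Z)%R)%N.
    near=> K => n nN0.
    have WK : W <= K%:R by near: K; exact: nbhs_infty_ger.
    have kK : (kk <= K)%N by near: K; exact: nbhs_infty_ge.
    have hp p : (p < P)%N -> (kap (m + p%:Z)%R <= K)%N /\
      mesh kap (m + p%:Z) <= eta m * (2 ^ K)%:R /\
      1 + n%:R * w <= eta m * mesh kap (m + p%:Z).
      move=> pP; split.
        by apply: leq_trans kK; rewrite /kk (bigD1 (Ordinal pP))//= leq_addr.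
      split.
        rewrite -ler_pdivrMl// mulrC; apply: le_trans (Wp (Ordinal pP)) _.
        by apply: le_trans WK _; rewrite ler_nat ltnW// ltn_expl.
      apply: (@le_trans _ _ (1 + (N0 m)%:R * w)).
        by rewrite lerD2l ler_wpM2r// ler_nat ltnW.
      rewrite -ler_pdivrMl// mulrC; apply: le_trans (ltW (truncnS_gt _)) _.
      rewrite ler_nat; apply: leq_trans (kap_ge m p pP) _.
      by rewrite ltnW// ltn_expl.
    have gc := grid_comb_error_le P0 (@cos_max R) cos_sub_le hp.
    have gs := grid_comb_error_le P0 (@sin_max R) sin_sub_le hp.
    apply: le_trans (lerD gc gs) _.
    by rewrite /eta le_eqVlt; apply/orP; left; apply/eqP; field.
rewrite !err ler_norml => /andP[h _].
have := eps0 m => e0; have : 0 < eps m * tau by rewrite mulr_gt0.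
by move=> e1; rewrite -/(g t); lra.
Unshelve. all: by end_near. Qed.

End reconstruction.

(** * Test sets in R^d *)

Section test_set.
Context {R : realType} {d : nat}.
Local Notation V := 'rV[R]_d.+1.
Local Notation T := (@rV_type R d).
Local Notation mu := (@rV_measure R d).

Lemma translate_setI (E : set V) (k : V -> R) (S : set R) x :
  (forall y z, k (y + z) = k y + k z) ->
  lebesgue_rV (translate E x `&` [set y | S (k y)]) =
  mu (E `&` [set y | S (k y + k x)]).
Proof.
move=> kD; rewrite -[RHS](lebesgue_rV_translate _ x); congr lebesgue_rV.
rewrite !translateE; apply/seteqP; split => y /= [h1 h2]; split => //;
  by move: h2; rewrite -kD subrK.
Qed.

Lemma Rintegral_indic_comp (E : set T) (k : T -> R) (S : set R) (t : R) :
  measurable E -> measurable_fun setT k -> measurable S ->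
  \int[mu]_(y in E) \1_S (k y + t) = fine (mu (E `&` [set y | S (k y + t)])).
Proof.
move=> mE mk mS.
have mB : measurable ([set y | S (k y + t)] : set T).
  have mkt : measurable_fun setT (fun y => k y + t) by exact: measurable_funD.
  by rewrite -[X in measurable X]setTI; exact: mkt.
rewrite -[RHS]mul1r -Rintegral_cst; last exact: measurableI.
rewrite Rintegral_mkcondr; apply: eq_Rintegral => y _.
rewrite patchE indicE; case: ifPn => [/set_mem h|/negP h]; first by rewrite mem_set.
by rewrite memNset// => ?; apply: h; rewrite inE.
Qed.

(** Equal overlaps force [X x = X x'] by strict monotonicity. The coefficient 3 exceeds
    [s + t <= 2], so if coordinate [i] carries the largest difference [a], then [3 a <= a + a] and
    [x = x']. *)
Lemma exists_test_set (E : set V) (i : 'I_d.+1) : (3 <= d.+1)%N -> bounded_set E ->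
  lebesgue_measurable E -> (0 < lebesgue_rV E)%E ->
  exists A : set V, lebesgue_measurable A /\ forall x x' : V, x <> x' ->
    (forall q, `|x 0 q - x' 0 q| <= `|x 0 i - x' 0 i|) ->
    lebesgue_rV (translate E x `&` A) <> lebesgue_rV (translate E x' `&` A).
Proof.
move=> d3 bE mE pE.
have [j ji] : exists j, j != i.
  have : (0 < #|predC1 i|)%N by rewrite cardC1 card_ord; exact: (leq_trans (isT : (0 < 2)%N) d3).
  by case/card_gt0P => j; rewrite inE => ?; exists j.
have [k /andP[ki kj]] : exists k, (k != i) && (k != j).
  have : (0 < #|~: [set i; j]|)%N.
    by rewrite cardsCs finset.setCK card_ord cards2 eq_sym ji subn_gt0.
  by case/card_gt0P => k; rewrite !inE negb_or => ?; exists k.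
have ij : i != j by rewrite eq_sym.
have ik : i != k by rewrite eq_sym.
have jk : j != k by rewrite eq_sym.
have [rho [rho0 hrho]] : exists rho : R, 0 < rho /\ forall x, E x -> forall q, `|x 0 q| <= rho.
  case: bE => M [_ hM]; exists (`|M| + 1); split; first by rewrite ltr_wpDl.
  move=> x Ex q; apply: le_trans (hM (`|M| + 1) _ x Ex); last by rewrite ltr_pwDr// ler_norm.
  rewrite -[leRHS]/(mx_norm x) mx_normrE.
  exact: (le_bigmax _ (fun ij : 'I_1 * 'I_d.+1 => `|x ij.1 ij.2|) (0, q)).
(* The coefficients [3, s, t] give [|X| <= 5 * rho] on [E], so this is [2 * A + 3] with
   [A = 5 * rho]. *)
pose P := (Num.truncn (10 * rho + 3)).+1.
have PR : 10 * rho + 3 <= P%:R by rewrite ltW// truncnS_gt.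
have P0 : 0 < P%:R :> R by rewrite ltr0n.
have EQ : E `<=` cube P%:R.
  move=> x Ex q; have := hrho x Ex q; rewrite !mxE ler_norml => /andP[? ?].
  by apply/andP; split; lra.
have mE' : measurable (E : set T) by [].
have muE : (mu E < +oo)%E.
  by apply: le_lt_trans (le_lebesgue_rV EQ) _; exact: measure_box_lty.
have [s [t [C [/andP[s0 s1] /andP[t0 t1] hC]]]] := exists_direction ij ik jk P0 mE' EQ pE.
pose X : T -> R := form3 i j k 3 s t.
have XA x : E x -> `|X x| <= 5 * rho.
  move=> /hrho h; rewrite /X /form3.
  have := h i; have := h j; have := h k; rewrite !ler_norml.
  move=> /andP[? ?] /andP[? ?] /andP[? ?]; apply/andP; split; nra.
have X0 c : mu.-negligible (E `&` [set x | X x = c]).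
  have c0 : coef3 i j k 3 s t i != 0 by rewrite coef3_i.
  exists (cube P%:R `&` [set x : V | linear_form (coef3 i j k 3 s t) x = c]); split.
  - apply: measurableI; first exact: measurable_box.
    rewrite -[X in measurable X]setTI.
    exact: (@measurable_linear_form R d _ measurableT [set c] (measurable_set1 _)).
  - exact: (measure_hyperplane0 _ _ _ c0).
  - by move=> x [Ex xc]; split; [exact: EQ|rewrite -form3E].
have mX : measurable_fun setT X by exact: measurable_form3.
have AP : 2 * (5 * rho) + 3 <= P%:R by rewrite mulrA -natrM.
have [S [mS incS]] := exists_increasing_overlap mE' muE pE mX XA AP X0 hC (ltn0Sn _).
have XD y z : X (y + z) = X y + X z by rewrite /X form3E linear_formD.
exists [set y | S (X y)]; split.
  by rewrite -measurable_rVE -[X in measurable X]setTI; exact: mX.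
move=> x x' xx' mxi; rewrite !translate_setI// => h.
have gE : \int[mu]_(y in E) \1_S (X y + X x) = \int[mu]_(y in E) \1_S (X y + X x') :> R.
  by rewrite !Rintegral_indic_comp// h.
have XX : X x = X x'.
  apply/eqP; rewrite eq_le !leNgt; apply/andP; split; apply/negP => /incS.
    by rewrite gE ltxx.
  by rewrite gE ltxx.
apply: xx'; apply/rowP => q; apply/eqP; rewrite -subr_eq0 -normr_le0.
apply: le_trans (mxi q) _.
have := mxi j; have := mxi k; set a := `|x 0 i - x' 0 i| => hk hj.
have E1 : 3 * (x 0 i - x' 0 i) = - (s * (x 0 j - x' 0 j) + t * (x 0 k - x' 0 k)).
  by move: XX; rewrite /X /form3 => XX; lra.
have : 3 * a <= a + a.
  rewrite -[3]normr_nat -normrM E1 normrN; apply: le_trans (ler_normD _ _) _.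
  rewrite !normrM (ger0_norm s0) (ger0_norm t0).
  apply: lerD; rewrite -[leRHS]mul1r; exact: ler_pM.
lra.
Qed.

End test_set.

Unset Implicit Arguments.

Theorem corollary5p9 (R : realType) (d : nat) (hd : (3 <= d)%N)
    (E : set 'rV[R]_d) (bE : bounded_set E) (mE : lebesgue_measurable E)
    (pE : (0 < lebesgue_rV E)%E) :
  exists T : 'I_d -> set 'rV[R]_d,
    (forall i, lebesgue_measurable (T i)) /\
    (forall x x' : 'rV[R]_d, x <> x' ->
      exists i : 'I_d,
        lebesgue_rV (translate E x `&` T i) <>
        lebesgue_rV (translate E x' `&` T i)).
Proof.
case: d => [//|d] in hd E bE mE pE *.
have /choice[T hT] := fun i => exists_test_set i hd bE mE pE.
exists T; split => [i|x x' xx']; first by have [] := hT i.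
(* The test set to use depends on the pair: it is the one of a coordinate in which [x] and [x']
   differ most. *)
have [_ /(_ x x' xx')] := hT [arg max_(i > ord0) `|x 0 i - x' 0 i|]%O.
case: arg_maxP => // i _ mxi h; exists i; apply: h => q; exact: mxi.
Qed.
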